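(* In the $k$-th iteration of the IA-NPE method (setting in the context), the bisection search makes at most $$O\left(\max\left\{\log L_2,\ \log d(x_+^0),\ \log M_1,\ \log M_0,\ \log L',\ \log\frac1{\bar\rho},\ \log\frac1{\bar\epsilon}\right\}\right)$$ oracle calls to compute a stepsize $\lambda_{k+1}>0$ that solves the line-search problem at the $k$-th iteration, i.e. a $\lambda_{k+1}>0$ with a $(\hat\sigma,\delta_k)$-approximate Newton solution $(y,u,\epsilon)$ at $(\lambda_{k+1},\tilde x(\lambda_{k+1}))$ satisfying $\alpha_-\le\lambda_{k+1}\|y-\tilde x(\lambda_{k+1})\|\le\alpha_+$.
   Context: Problem: minimize $f=g+h$ on $\mathbb{R}^d$; $g,h$ proper closed convex, $g$ twice continuously differentiable with $L_2$-Lipschitz Hessian, $h$ $L'$-Lipschitz; $x_*$ is a minimizer and $d(x)$ denotes the distance of $x$ to $x_*$. For $\varepsilon\ge0$, $\partial_\varepsilon h(x)=\{v: h(y)\ge h(x)+\langle y-x,v\rangle-\varepsilon\ \forall y\}$. $H(x)\succeq0$ satisfies $\|H(x)-\nabla^2g(x)\|<\delta$, $H(\cdot)$ is $L_2$-Lipschitz, and $g_{x,\delta}(y)=g(x)+\langle\nabla g(x),y-x\rangle+\frac12\langle y-x,H(x)(y-x)\rangle$. $(y,u,\varepsilon)\in\mathrm{ANS}_{\hat\sigma,\delta}(\lambda,x)$, a $(\hat\sigma,\delta)$-approximate Newton solution at $(\lambda,x)$, means $\varepsilon\ge0$, $u\in(\nabla g_{x,\delta}+\partial_\varepsilon h)(y)$,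 $\|\lambda u+y-x\|^2+2\lambda\varepsilon\le\hat\sigma^2\|y-x\|^2$. One oracle call = one computation of such a triple. IA-NPE parameters: $C,\bar\rho,\bar\epsilon,\delta_{-1}>0$, $\delta_{\max}>\delta_{-1}$, $\gamma>1$, $0<\sigma_l<\sigma_u<1$, $0<\hat\sigma<1$, $\hat\sigma+\sigma_u<1$, $\sigma_l(1+\hat\sigma)<\sigma_u(1-\hat\sigma)$, $\tilde\sigma=C+\sigma_u+\hat\sigma<1$. Before the search in iteration $k$, the method sets $\delta_k=\min\{\gamma\delta_{k-1},\delta_{\max}\}$, $\lambda_{k+1}=C/\delta_k$, computes $(\tilde y_{k+1},u_{k+1},\epsilon_{k+1})\in\mathrm{ANS}_{\hat\sigma,\delta_k}(\lambda_{k+1},\tilde x(\lambda_{k+1}))$, and while $\lambda_{k+1}\|\tilde y_{k+1}-\tilde x(\lambda_{k+1})\|<2\sigma_l/L_2$ replaces $\delta_k$ by $\delta_k/\gamma$, sets $\lambda_{k+1}=C/\delta_k$, and recomputes. The bisection search is invoked if afterwards $\lambda_{k+1}\|\tilde y_{k+1}-\tilde x(\lambda_{k+1})\|>2\sigma_u/L_2$, with $\delta=\delta_k$, $\lambda_+^0=\lambda_{k+1}=C/\delta_k$, $\alpha_-=2\sigma_l/L_2$, $\alpha_+=2\sigma_u/L_2$. The curve $\tilde x:[0,\infty)\to\mathbb{R}^d$ (in IA-NPE: $\tilde x(\lambda)=\frac{A_k}{A_k+a}y_k+\frac{a}{A_k+a}x_k$, $a=\frac{\lambda+\sqrt{\lambda^2+4\lambda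 A_k}}2$, with $x_k,y_k\in\mathbb{R}^d$ the current iterates and $A_k\ge0$ the current accumulated weight) satisfies, for constants $M_0,M_1>0$, $\|\tilde x(s)-\tilde x(t)\|\le\min\{\frac{M_0}{t}(s-t),\,M_1\|\tilde x(s)-\tilde x(0)\|\}$ for $0<t\le s$. Standing assumption (no early termination): whenever an approximate Newton solution $(y,u,\varepsilon)$ at some $(\lambda,\tilde x(\lambda))$ is computed and $v=\nabla g(y)-\nabla g_{\tilde x(\lambda),\delta}(y)+u$, one has $\|v\|>\bar\rho$ or $\varepsilon>\bar\epsilon$. Bisection search: with $x_+^0=\tilde x(\lambda_+^0)$, $(y_+^0,u_+^0,\epsilon_+^0)\in\mathrm{ANS}_{\hat\sigma,\delta}(\lambda_+^0,x_+^0)$, $\gamma_0=M_1\lambda_+^0\|x_+^0-\tilde x(0)\|$, set $$\lambda_-^0=\frac{(1-\hat\sigma)\alpha_-\lambda_+^0}{(1+\hat\sigma)(1+2L_2\gamma_0)\lambda_+^0\|y_+^0-x_+^0\|+(1+2C)\gamma_0+L_2\gamma_0^2}$$ and compute an approximate Newton solution at $(\lambda_-^0,\tilde x(\lambda_-^0))$. Start with $\lambda_-=\lambda_-^0$, $\lambda_+=\lambda_+^0$ and repeat: $\lambda=(\lambda_-+\lambda_+)/2$, compute $(y_\lambda,u_\lambda,\epsilon_\lambda)\in\mathrm{ANS}_{\hat\sigma,\delta}(\lambda,\tilde x(\lambda))$; stop if $\lambda\|y_\lambda-\tilde x(\lambda)\|\in[\alpha_-,\alpha_+]$; else set $\lambda_+=\lambda$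 if it exceeds $\alpha_+$, $\lambda_-=\lambda$ if it is below $\alpha_-$. $O(\cdot)$ suppresses constants depending on the algorithmic parameters ($C,\sigma_l,\sigma_u,\hat\sigma,\gamma,\delta_{-1},\delta_{\max}$). *)

(* Defs.v *)
From HB Require Import structures.
From mathcomp Require Import all_boot all_order all_algebra.
From mathcomp Require Import all_classical all_reals all_analysis.
Import Order.TTheory GRing.Theory Num.Theory.
Import numFieldNormedType.Exports.

Set Implicit Arguments.
Unset Strict Implicit.
Unset Printing Implicit Defensive.

Local Open Scope classical_set_scope.
Local Open Scope ring_scope.

(* Vectors of R^d are rows, so a matrix M acts on v as v *m M; the matrices H
   below are symmetric, so this agrees with the column convention.
   The library norm `|v| on 'rV_d is the sup norm: it is only used, through
   differentiability and continuity, for the topology.  All metric quantities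
   use the Euclidean norm [enorm] and the operator norm it induces. *)
Section Euclidean.
Context {R : realType} {d : nat}.
Implicit Types (u v x y : 'rV[R]_d) (M : 'M[R]_d).

Definition dot u v : R := \sum_(i < d) u 0 i * v 0 i.

Definition enorm v : R := Num.sqrt (dot v v).

Definition opnorm M : R := sup [set enorm (v *m M) | v in [set v | enorm v <= 1]].

Definition psd M : Prop := M^T = M /\ forall v, 0 <= dot (v *m M) v.

Definition gradient (f : 'rV[R]_d -> R) x : 'rV[R]_d :=
  \row_(i < d) 'D_(delta_mx 0 i) f x.

Definition hessian (f : 'rV[R]_d -> R) x : 'M[R]_d := jacobian (gradient f) x.

Definition twice_cont_diff (f : 'rV[R]_d -> R) : Prop :=
  [/\ forall x, differentiable f x,
      forall x, differentiable (gradient f) x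
    & continuous (hessian f)].

Definition eps_subdiff (h : 'rV[R]_d -> R) (eps : R) x v : Prop :=
  forall y, h x + dot (y - x) v - eps <= h y.

End Euclidean.

(* [h] is Lipschitz on R^d, hence real-valued, and so is the twice
   differentiable [g]: both are automatically proper and closed.
   [H delta] is the Hessian approximation of accuracy [delta]. *)
Record problem (R : realType) (d : nat) := Problem {
  g : 'rV[R]_d -> R;
  h : 'rV[R]_d -> R;
  xstar : 'rV[R]_d;
  L2 : R;
  Lh : R;
  H : R -> 'rV[R]_d -> 'M[R]_d
}.

Record problem_ok (R : realType) (d : nat) (P : problem R d) : Prop := ProblemOk {
  g_convex : convex_function [set: 'rV[R]_d] (g P);
  g_C2 : twice_cont_diff (g P);
  L2_gt0 : 0 < L2 P;
  g_hess_lip : forall x y,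
    opnorm (hessian (g P) x - hessian (g P) y) <= L2 P * enorm (x - y);
  h_convex : convex_function [set: 'rV[R]_d] (h P);
  Lh_ge0 : 0 <= Lh P;
  h_lip : forall x y, `|h P x - h P y| <= Lh P * enorm (x - y);
  xstar_min : forall x, g P (xstar P) + h P (xstar P) <= g P x + h P x;
  H_psd : forall delta x, 0 < delta -> psd (H P delta x);
  H_close : forall delta x, 0 < delta ->
    opnorm (H P delta x - hessian (g P) x) < delta;
  H_lip : forall delta x y, 0 < delta ->
    opnorm (H P delta x - H P delta y) <= L2 P * enorm (x - y)
}.

Record params (R : realType) := Params {
  C : R;
  gamma : R;
  sigma_l : R;
  sigma_u : R;
  hsigma : R;
  delta_init : R;  (* delta_{-1} *)
  delta_max : R
}.

Record params_ok (R : realType) (p : params R) : Prop := ParamsOk {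
  C_gt0 : 0 < C p;
  gamma_gt1 : 1 < gamma p;
  sigma_l_gt0 : 0 < sigma_l p;
  sigma_lu : sigma_l p < sigma_u p;
  sigma_u_lt1 : sigma_u p < 1;
  hsigma_gt0 : 0 < hsigma p;
  hsigma_lt1 : hsigma p < 1;
  hsigma_sigma_u : hsigma p + sigma_u p < 1;
  sigma_gap : sigma_l p * (1 + hsigma p) < sigma_u p * (1 - hsigma p);
  tsigma_lt1 : C p + sigma_u p + hsigma p < 1;
  delta_init_gt0 : 0 < delta_init p;
  delta_init_max : delta_init p < delta_max p
}.

Record triple (R : realType) (d : nat) := Triple {
  pt : 'rV[R]_d;
  du : 'rV[R]_d;
  err : R
}.

Section IA_NPE.
Context {R : realType} {d : nat}.
Variables (p : params R) (P : problem R d).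
Implicit Types (x y : 'rV[R]_d) (lambda delta : R) (t : triple R d).

Definition gmodel delta x y : R :=
  g P x + dot (gradient (g P) x) (y - x)
  + 2^-1 * dot (y - x) ((y - x) *m H P delta x).

Definition ANS delta lambda x t : Prop :=
  [/\ 0 <= err t,
      exists2 v, eps_subdiff (h P) (err t) (pt t) v
               & du t = gradient (gmodel delta x) (pt t) + v
    & enorm (lambda *: du t + pt t - x) ^+ 2 + 2 * lambda * err t
        <= hsigma p ^+ 2 * enorm (pt t - x) ^+ 2].

Definition residual delta x t : 'rV[R]_d :=
  gradient (g P) (pt t) - gradient (gmodel delta x) (pt t) + du t.

(* An oracle answer which does not trigger early termination. *)
Definition computed (rho eps delta lambda : R) x t : Prop :=
  ANS delta lambda x t /\ (rho < enorm (residual delta x t) \/ eps < err t).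

(* For A = 0 and lambda = 0 the two quotients are 0/0; the value is then the
   limit as lambda goes to 0 (the curve is constant when A = 0). *)
Definition curve (A : R) (xk yk : 'rV[R]_d) lambda : 'rV[R]_d :=
  let a := (lambda + Num.sqrt (lambda ^+ 2 + 4 * lambda * A)) / 2 in
  if A + a == 0 then xk else (A / (A + a)) *: yk + (a / (A + a)) *: xk.

Definition alpha_minus : R := 2 * sigma_l p / L2 P.
Definition alpha_plus : R := 2 * sigma_u p / L2 P.

Section Search.
Variables (rho eps : R) (xt : R -> 'rV[R]_d).

Definition large_step lambda t : R := lambda * enorm (pt t - xt lambda).

(* [delta_search delta delta' t]: the loop entered with [delta] is left with
   accuracy [delta'], and [t] is the last triple it computed. *)
Inductive delta_search : R -> R -> triple R d -> Prop :=
| delta_stop delta t :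
    computed rho eps delta (C p / delta) (xt (C p / delta)) t ->
    alpha_minus <= large_step (C p / delta) t ->
    delta_search delta delta t
| delta_shrink delta t delta' t' :
    computed rho eps delta (C p / delta) (xt (C p / delta)) t ->
    large_step (C p / delta) t < alpha_minus ->
    delta_search (delta / gamma p) delta' t' ->
    delta_search delta delta' t'.

Section Bisection.
Variables (M1 lambda_plus0 : R) (t_plus0 : triple R d).

Definition gamma0 : R := M1 * lambda_plus0 * enorm (xt lambda_plus0 - xt 0).

Definition lambda_minus0 : R :=
  ((1 - hsigma p) * alpha_minus * lambda_plus0)
  / ((1 + hsigma p) * (1 + 2 * L2 P * gamma0) * lambda_plus0
       * enorm (pt t_plus0 - xt lambda_plus0)
     + (1 + 2 * C p) * gamma0 + L2 P * gamma0 ^+ 2).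

(* [ts n] is the oracle answer at the midpoint of the n-th bracket
   (lambda_-, lambda_+). *)
Fixpoint bracket (ts : nat -> triple R d) (n : nat) : R * R :=
  if n is m.+1 then
    let: (lo, hi) := bracket ts m in
    let lambda := (lo + hi) / 2 in
    if alpha_plus < large_step lambda (ts m) then (lo, lambda)
    else if large_step lambda (ts m) < alpha_minus then (lambda, hi)
    else (lo, hi)
  else (lambda_minus0, lambda_plus0).

Definition midpoint (ts : nat -> triple R d) (n : nat) : R :=
  ((bracket ts n).1 + (bracket ts n).2) / 2.

Definition accepted (ts : nat -> triple R d) (n : nat) : bool :=
  alpha_minus <= large_step (midpoint ts n) (ts n) <= alpha_plus.

End Bisection.
End Search.
End IA_NPE.

(* Main.v *)
Require Import Defs.
From HB Require Import structures.
From mathcomp Require Import all_boot all_order all_algebra.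
From mathcomp Require Import all_classical all_reals all_analysis.
From mathcomp Require Import ring lra.
Import Order.TTheory GRing.Theory Num.Theory.
Import numFieldNormedType.Exports.

(** Why the theorem holds.  At each stage the bisection keeps a bracket whose
lower end has an approximate Newton solution with a large-step product
[lambda * |y - x|] at most [alpha_minus], and whose upper end has one with
product above [alpha_plus].  Two facts bound the number of halvings.

A bracket of this kind cannot be too short ([bracket_gap]).  Along the curve the
product varies in a controlled way: [ANS_compare] bounds the displacement of one
approximate solution by that of another computed at a different stepsize and a
different centre, up to the factor (1 + hsigma) / (1 - hsigma), which the
condition on sigma_l and sigma_u leaves room for.  So the relative length of the
bracket is at least a constant over [1 + L2 * lambda * M0], whence
[2 ^ n <= const * (lambda / lambda_minus0) * (1 + L2 * lambda * M0)] as long as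
no midpoint is accepted ([bisection_count]).

The right-hand side is polynomially bounded in the data ([bracket_ratio_le]).
It depends on [lambda] only through [X = L2 * lambda]:
- [X] itself is bounded because [lambda = C / delta_k], and [delta_k] is either
  at least [delta_init] or goes back to a division after a small step;
  a small step with a long stepsize would have a small residual and a small
  error, contradicting the absence of early termination ([accuracy_lower]);
- the displacement at the upper end is bounded by the distance to the minimizer,
  which is itself an exact Newton solution with zero displacement
  ([dist_ANS_le_minimizer]);
- the curve stays within [10 * M0] of its starting point ([curve_dist0_le]).
Taking logarithms gives the bound.

The comparison of two approximate solutions avoids the exact Newton step, hence
any existence result for it: subtracting the two inclusions and using
approximate monotonicity directly gives constants sharp enough for the prescribed
lower stepsize [lambda_minus0]. *)

Local Open Scope ring_scope.

(** * Euclidean geometry of row vectors *)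

Section Euclidean.
Context {R : realType} {d : nat}.
Implicit Types (u v w x y : 'rV[R]_d) (M : 'M[R]_d) (a b : R).

Lemma dotC u v : dot u v = dot v u.
Proof. by apply: eq_bigr => i _; rewrite mulrC. Qed.

Lemma dotDl u v w : dot (u + v) w = dot u w + dot v w.
Proof. by rewrite -big_split; apply: eq_bigr => i _; rewrite mxE mulrDl. Qed.

Lemma dotZl a u v : dot (a *: u) v = a * dot u v.
Proof. by rewrite mulr_sumr; apply: eq_bigr => i _; rewrite mxE mulrA. Qed.

Lemma dotNl u v : dot (- u) v = - dot u v.
Proof. by rewrite -scaleN1r dotZl mulN1r. Qed.

Lemma dotDr u v w : dot u (v + w) = dot u v + dot u w.
Proof. by rewrite dotC dotDl !(dotC u). Qed.

Lemma dotZr a u v : dot u (a *: v) = a * dot u v.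
Proof. by rewrite dotC dotZl dotC. Qed.

Lemma dotNr u v : dot u (- v) = - dot u v.
Proof. by rewrite dotC dotNl dotC. Qed.

Lemma dot0l u : dot 0 u = 0.
Proof. by rewrite -(scale0r 0) dotZl mul0r. Qed.

Lemma dot0r u : dot u 0 = 0.
Proof. by rewrite dotC dot0l. Qed.

Definition dotE := (dotDl, dotDr, dotNl, dotNr, dotZl, dotZr).

Lemma dotvv_ge0 u : 0 <= dot u u.
Proof. by apply: sumr_ge0 => i _; rewrite -expr2 sqr_ge0. Qed.

Lemma enorm_ge0 u : 0 <= enorm u.
Proof. exact: sqrtr_ge0. Qed.

Lemma sqr_enorm u : enorm u ^+ 2 = dot u u.
Proof. by rewrite sqr_sqrtr // dotvv_ge0. Qed.

Lemma enorm0 : enorm (0 : 'rV[R]_d) = 0.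
Proof. by rewrite /enorm dot0l sqrtr0. Qed.

Lemma enormZ a u : enorm (a *: u) = `|a| * enorm u.
Proof.
by rewrite /enorm !dotE mulrA -expr2 sqrtrM ?sqr_ge0 // sqrtr_sqr.
Qed.

Lemma enormN u : enorm (- u) = enorm u.
Proof. by rewrite /enorm !dotE opprK. Qed.

Lemma enormB u v : enorm (u - v) = enorm (v - u).
Proof. by rewrite -enormN opprB. Qed.

Lemma enorm_eq0 u : enorm u = 0 -> u = 0.
Proof.
move=> u0; have : dot u u = 0 by rewrite -sqr_enorm u0 expr0n.
move=> /eqP; rewrite psumr_eq0 => [/allP h|i _]; last by rewrite -expr2 sqr_ge0.
apply/rowP => i; rewrite mxE.
by have := h i (mem_index_enum _); rewrite mulf_eq0 orbb => /eqP.
Qed.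

(** Cauchy-Schwarz, from the nonnegativity of the squared norm of
[enorm v *: u - enorm u *: v]. *)
Lemma dot_le u v : dot u v <= enorm u * enorm v.
Proof.
have [u0|u0] := eqVneq (enorm u) 0.
  by rewrite (enorm_eq0 u u0) dot0l enorm0 mul0r.
have [v0|v0] := eqVneq (enorm v) 0.
  by rewrite (enorm_eq0 v v0) dot0r enorm0 mulr0.
have un : 0 < enorm u by rewrite lt_def u0 enorm_ge0.
have vn : 0 < enorm v by rewrite lt_def v0 enorm_ge0.
have := dotvv_ge0 (enorm v *: u - enorm u *: v).
rewrite !dotE (dotC v u) -!sqr_enorm => h.
suff: 0 <= 2 * (enorm u * enorm v) * (enorm u * enorm v - dot u v).
  by rewrite pmulr_rge0 ?subr_ge0 // mulr_gt0 // mulr_gt0.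
by apply: le_trans h _; rewrite le_eqVlt; apply/orP; left; apply/eqP; ring.
Qed.

Lemma dot_geN u v : - (enorm u * enorm v) <= dot u v.
Proof. by rewrite lerNl -dotNr -(enormN v) dot_le. Qed.

Lemma enormD u v : enorm (u + v) <= enorm u + enorm v.
Proof.
rewrite -(@ler_pXn2r _ 2) ?nnegrE ?addr_ge0 ?enorm_ge0 //.
rewrite sqrrD !sqr_enorm !dotE (dotC v u).
have := dot_le u v; lra.
Qed.

Lemma enorm_sum (I : finType) (f : I -> 'rV[R]_d) :
  enorm (\sum_i f i) <= \sum_i enorm (f i).
Proof.
apply: (big_ind2 (fun u r => enorm u <= r)) => [|u r v s ur vs|//].
  by rewrite enorm0.
by apply: le_trans (enormD u v) _; rewrite lerD.
Qed.

Lemma coord_le_enorm u i : `|u 0 i| <= enorm u.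
Proof.
rewrite -sqrtr_sqr; apply: ler_wsqrtr; rewrite /dot (bigD1 i) //= expr2 lerDl.
by apply: sumr_ge0 => j _; rewrite -expr2 sqr_ge0.
Qed.

(** A crude bound, whose only purpose is to make the supremum in [opnorm]
finite. *)
Lemma enorm_mulmx_le_rows M v :
  enorm (v *m M) <= (\sum_i enorm (row i M)) * enorm v.
Proof.
rewrite mulmx_sum_row (le_trans (enorm_sum _ _)) // mulr_suml.
by apply: ler_sum => i _; rewrite enormZ mulrC ler_wpM2l ?enorm_ge0 ?coord_le_enorm.
Qed.

Lemma opnorm_le M v : enorm (v *m M) <= opnorm M * enorm v.
Proof.
have [v0|v0] := eqVneq (enorm v) 0.
  by rewrite (enorm_eq0 v v0) mul0mx enorm0 mulr0.
have vn : 0 < enorm v by rewrite lt_def v0 enorm_ge0.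
rewrite -ler_pdivrMr //; apply: ub_le_sup.
  exists (\sum_i enorm (row i M)) => _ [w /= w1 <-].
  apply: le_trans (enorm_mulmx_le_rows M w) _; rewrite ler_piMr //.
  by apply: sumr_ge0 => i _; exact: enorm_ge0.
exists ((enorm v)^-1 *: v) => /=; last first.
  by rewrite -scalemxAl enormZ ger0_norm ?invr_ge0 ?enorm_ge0 // mulrC.
by rewrite enormZ ger0_norm ?invr_ge0 ?enorm_ge0 // mulVf.
Qed.

Lemma dot_continuous v : continuous (fun u => dot u v : R).
Proof.
move=> u; apply: (@cvg_big _ _ _ _ _ add_continuous _ _ _ _ _ (nbhs_filter u)) => i _.
by apply: cvgMl; exact: coord_continuous.
Qed.

End Euclidean.

(** * Derivatives along lines *)

Section Calculus.
Local Open Scope classical_set_scope.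
Context {R : realType} {d : nat}.
Implicit Types (u v w x y : 'rV[R]_d) (M : 'M[R]_d) (a b : R).

Lemma is_derive_dot_line (f : 'rV[R]_d -> 'rV[R]_d) x v n (s : R) :
  differentiable f (x + s *: v) ->
  is_derive s 1 (fun r : R => dot (f (x + r *: v)) n)
    (dot (v *m jacobian f (x + s *: v)) n).
Proof.
move=> df; have dv := @diff_derivable _ _ _ f _ v df.
have cv : (fun h : R => h^-1 *: (f (h *: v + (x + s *: v)) - f (x + s *: v)))
   @ 0^' --> v *m jacobian f (x + s *: v).
  by rewrite -(deriveEjacobian v df); exact: dv.
have cd : (fun h : R => h^-1 *: (dot (f (x + (h *: 1 + s) *: v)) n
   - dot (f (x + s *: v)) n)) @ 0^' --> dot (v *m jacobian f (x + s *: v)) n.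
  have -> : (fun h : R => h^-1 *: (dot (f (x + (h *: 1 + s) *: v)) n
   - dot (f (x + s *: v)) n)) = (fun u => dot u n) \o
     (fun h : R => h^-1 *: (f (h *: v + (x + s *: v)) - f (x + s *: v))).
    apply/funext => h /=; rewrite !dotE [h *: 1]mulr1 scalerDl addrCA.
    by [].
  by apply: continuous_cvg => //; exact: dot_continuous.
split; first by apply/cvg_ex; exists (dot (v *m jacobian f (x + s *: v)) n).
exact/cvg_lim.
Qed.

(** The remainder [n] is tested against itself: the scalar function
[s |-> dot (f (x + s *: p)) n - s * D 0 - c / 2 * s ^ 2] has a nonpositive
derivative, so the mean value theorem bounds [|n| ^ 2] by a multiple of [|n|]. *)
Lemma taylor_lipschitz_jacobian (f : 'rV[R]_d -> 'rV[R]_d) (L : R) x y :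
  0 <= L -> (forall z, differentiable f z) ->
  (forall z w, opnorm (jacobian f z - jacobian f w) <= L * enorm (z - w)) ->
  enorm (f y - f x - (y - x) *m jacobian f x) <= L / 2 * enorm (y - x) ^+ 2.
Proof.
move=> L0 df lipf; set p := y - x; set n := _ - _.
have [n0|n0] := eqVneq (enorm n) 0.
  by rewrite n0 mulr_ge0 ?sqr_ge0 // divr_ge0.
have np : 0 < enorm n by rewrite lt_def n0 enorm_ge0.
pose c := L * enorm p ^+ 2 * enorm n.
pose F (s : R) := dot (f (x + s *: p)) n.
pose D (s : R) := dot (p *m jacobian f (x + s *: p)) n.
pose psi (s : R) : R := F s - (s * D 0 + c / 2 * s ^+ 2).
have dF (s : R) : is_derive s 1 F (D s) by exact: is_derive_dot_line.
have dpsi (s : R) : is_derive s 1 psi (D s - D 0 - c * s).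
  apply: is_derive_eq.
  rewrite /GRing.scale /=; move: (D s) (D 0) (c) => u v w; clear; lra.
have cpsi : {within `[0, 1], continuous psi}.
  apply: continuous_subspaceT => s; apply: differentiable_continuous.
  by apply/derivable1_diffP; have [] := dpsi s.
have [xi] := MVT ltr01 (fun s _ => dpsi s) cpsi.
rewrite in_itv /= => /andP [xi0 xi1].
have Dxi : D xi - D 0 <= c * xi.
  rewrite /D -dotNl -dotDl -mulmxBr (le_trans (dot_le _ _)) //.
  rewrite /c mulrAC ler_wpM2r ?enorm_ge0 // (le_trans (opnorm_le _ _)) //.
  rewrite expr2 mulrA mulrAC ler_wpM2r ?enorm_ge0 // (le_trans (lipf _ _)) //.
  rewrite scale0r addr0 addrC addKr enormZ ger0_norm ?(ltW xi0) //.
  by rewrite mulrCA mulrC.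
have Fn : F 1 - F 0 - D 0 = enorm n ^+ 2.
  have -> : F 1 = dot (f y) n by rewrite /F scale1r /p addrC subrK.
  rewrite sqr_enorm [in RHS]/n dotDl dotDl !dotNl -/n /F /D scale0r addr0.
  by [].
rewrite /psi => h.
have h2 : enorm n ^+ 2 <= c / 2.
  rewrite -Fn; move: Dxi xi0 xi1 h; move: (D xi) (D 0) (F 1) (F 0) (c); clear.
  by move=> D1 D0 F1 F0 e; nra.
rewrite -(ler_pM2r np) -expr2 (le_trans h2) // /c; move: (enorm n) (enorm p).
by clear => a b; rewrite le_eqVlt; apply/orP; left; apply/eqP; field.
Qed.

(** A function that is quadratic along a line needs no derivation rules: its
difference quotient is affine in [s]. *)
Lemma derive_line (f : 'rV[R]_d -> R) x v (c b : R) :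
  (forall s : R, f (s *: v + x) - f x = s * c + s ^+ 2 * b) -> 'D_v f x = c.
Proof.
move=> fE; apply/cvg_lim => //.
have : (fun s : R => c + s * b) @ 0^' --> c + 0 * b.
  apply: cvgD; first exact: cvg_cst.
  by apply: cvgMl; apply: cvg_within.
rewrite mul0r addr0; apply: cvg_trans; apply: near_eq_cvg.
near=> s; rewrite /= fE /GRing.scale /= expr2 -mulrA -mulrDr mulKf //.
by near: s; exact: nbhs_dnbhs_neq.
Unshelve. all: by end_near. Qed.

Lemma dot_delta v i : dot v (delta_mx 0 i) = v 0 i.
Proof.
rewrite /dot (bigD1 i) //= big1 => [|j ji]; rewrite mxE ?eqxx ?mulr1 ?addr0 //.
by rewrite (negPf ji) andbF mulr0.
Qed.

Lemma dot_mulmx_trmx u v M : dot (u *m M) v = dot u (v *m M^T).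
Proof.
rewrite /dot; under eq_bigr do rewrite mxE mulr_suml.
rewrite exchange_big; apply: eq_bigr => i _ /=; rewrite mxE mulr_sumr.
by apply: eq_bigr => j _; rewrite mxE; ring.
Qed.

Lemma gradient_gmodel (P : problem R d) delta x y :
  problem_ok P -> 0 < delta ->
  gradient (gmodel P delta x) y = gradient (g P) x + (y - x) *m H P delta x.
Proof.
move=> Pok d0; apply/rowP => i; rewrite mxE.
have [Hs _] := H_psd Pok x d0.
set e := delta_mx 0 i; set G := gradient _ _ + _.
apply: (@derive_line _ _ _ _ (2^-1 * dot e (e *m H P delta x))) => s.
rewrite -[G 0 i]dot_delta -/e /gmodel.
have -> : s *: e + y - x = s *: e + (y - x) by rewrite addrA.
rewrite /G {G}; move: (y - x) => q; rewrite mulmxDl -scalemxAl !dotE.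
have -> : dot (q *m H P delta x) e = dot q (e *m H P delta x).
  by rewrite dot_mulmx_trmx Hs.
have -> : dot e (q *m H P delta x) = dot q (e *m H P delta x).
  by rewrite dotC dot_mulmx_trmx Hs.
lra.
Qed.

(** Convexity of [h] turns minimality along the segment from [xstar] to [y] into
a bound of [h y - h xstar] by minus the difference quotient of [g], which
converges to a directional derivative.  This makes the minimizer an exact Newton
solution. *)
Lemma minimizer_subgradient (P : problem R d) : problem_ok P ->
  eps_subdiff (h P) 0 (xstar P) (- gradient (g P) (xstar P)).
Proof.
move=> Pok y; have [dg _ _] := g_C2 Pok.
set x := xstar P; set v := y - x; rewrite subr0 dotNr.
suff h0 : - (h P y - h P x) <= 'D_v (g P) x.
  move: h0; suff -> : 'D_v (g P) x = dot v (gradient (g P) x) by lra.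
  rewrite deriveE //.
  rewrite {1}(row_sum_delta v) linear_sum; apply: eq_bigr => i _.
  have -> : gradient (g P) x 0 i = 'd (g P) x (delta_mx 0 i).
    by rewrite mxE deriveE.
  by rewrite linearZ.
have cv : (fun s : R => s^-1 *: (g P (s *: v + x) - g P x)) @ 0^'+ --> 'D_v (g P) x.
  by apply: cvg_dnbhs_at_right; exact: (diff_derivable (dg x)).
apply: (cvgr_to_ge cv); near=> s.
have s0 : 0 < s by [].
have s1 : s <= 1 by near: s; exact: nbhs_right_le.
have sI : (0 <= s <= 1)%R by rewrite (ltW s0) s1.
have hc : h P (s *: v + x) <= s * h P y + (1 - s) * h P x.
  have := h_convex Pok (Itv01 (ltW s0) s1) (x := y) (y := x).
  move=> /(_ (mem_set I) (mem_set I)).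
  have -> : s *: v + x = s *: y + (1 - s) *: x.
    by rewrite scalerBl scale1r /v scalerBr -addrA [- _ + x]addrC.
  exact.
have gm := xstar_min Pok (s *: v + x).
rewrite /GRing.scale /= ler_pdivlMl // -/x in gm *.
lra.
Unshelve. all: by end_near. 
Qed.

End Calculus.

(** * Comparison of two inexact resolvents *)

Section Compare.
Context {R : realType} {d : nat}.
Implicit Types (u v w x y : 'rV[R]_d) (a b : R).

(** Among all [w] and [v] of given norms the inner product is smallest when both
are parallel to [y], against it for [w] and along it for [v].  By Cauchy-Schwarz
the excess over that value is at least
[(|w| + |v| - m) * (|y| - (m + |w| + |v|) / 2)] with [m = |w - v|]. *)
Lemma dot_perturbed_lower y w v (S : R) :
  dot (y + w) (y - v) <= S -> enorm w + enorm v <= enorm y ->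
  (enorm y - enorm w) * (enorm y - enorm v) <= S.
Proof.
move=> hS hy.
have e1 : enorm (w - v) ^+ 2 = enorm w ^+ 2 + enorm v ^+ 2 - 2 * dot w v.
  by rewrite !sqr_enorm !dotE (dotC v w); ring.
have m1 : enorm (w - v) <= enorm w + enorm v by rewrite -(enormN v) enormD.
have c1 := dot_geN y (w - v).
have m0 := enorm_ge0 (w - v).
move: hS c1; rewrite !dotE -!sqr_enorm (dotC w y) => hS c1.
move: e1 m1 m0 c1 hS hy.
move: (enorm (w - v)) (enorm w) (enorm v) (enorm y).
move: (dot w v) (dot y w) (dot y v) => wv yw yv m p q z e1 m1 m0 c1 hS hy.
have : 0 <= (p + q - m) * (z - (m + p + q) / 2) by rewrite mulr_ge0 //; lra.
by lra.
Qed.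

(** The inner product in the last hypothesis is the stepsize of [b] times the one
that monotonicity bounds from below: [qa], [qb] are displacements, [wa], [wb] the
proximal residuals, [theta] the ratio of stepsizes, [e] the change of operator
and [Delta] the change of centre.  With [y] the perturbed difference of the
displacements, [dot_perturbed_lower] bounds [|y|] by
[|v| + sigma * (|qb| + theta * |qa|)]; the triangle inequality then gives the
claim.  The inexactness of the inclusions costs half the differences of squares
[(sigma * |q|) ^ 2 - |w| ^ 2], and each of these is at most [sigma * |q|] times
what [w] leaves of its tolerance [sigma * |q|], so the total is covered by the
product of the two factors in [dot_perturbed_lower].  In that product the term of
[a] has the weight [theta ^ 2] instead of [theta]; the alternative compensates
for it. *)
Lemma inexact_resolvent_compare (sigma theta : R)
    (qa qb wa wb e Delta : 'rV[R]_d) :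
  0 <= sigma -> 0 <= theta ->
  enorm wa <= sigma * enorm qa -> enorm wb <= sigma * enorm qb ->
  1 <= theta \/ enorm qa <= enorm qb ->
  - (((sigma * enorm qb) ^+ 2 - enorm wb ^+ 2
      + theta * ((sigma * enorm qa) ^+ 2 - enorm wa ^+ 2)) / 2)
    <= dot (theta *: (wa - qa) - e - (wb - qb)) (qa - qb + Delta) ->
  (1 - sigma) * enorm qb
    <= (`|1 - theta| + (1 + sigma) * theta) * enorm qa
       + 2 * enorm e + enorm Delta.
Proof.
move=> s0 t0 ha hb tab hdot; rewrite leNgt; apply/negP => hlt.
pose y := qb - theta *: qa - e; pose w := theta *: wa - wb.
pose v := - e + (1 - theta) *: qa + Delta.
have yqb : enorm qb <= enorm y + enorm e + theta * enorm qa.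
  have {1}-> : qb = y + e + theta *: qa by rewrite /y !subrK.
  by rewrite (le_trans (enormD _ _)) // enormZ ger0_norm // lerD2r enormD.
have hv : enorm v <= enorm e + `|1 - theta| * enorm qa + enorm Delta.
  rewrite /v (le_trans (enormD _ _)) // lerD2r (le_trans (enormD _ _)) //.
  by rewrite enormN enormZ.
have hw : enorm w <= theta * enorm wa + enorm wb.
  by rewrite (le_trans (enormD _ _)) // enormN enormZ ger0_norm.
have hyv : dot (y + w) (y - v) <= ((sigma * enorm qb) ^+ 2 - enorm wb ^+ 2
      + theta * ((sigma * enorm qa) ^+ 2 - enorm wa ^+ 2)) / 2.
  rewrite -lerN2 (le_trans hdot) // -dotNr le_eqVlt; apply/orP; left; apply/eqP.
  congr dot; apply/rowP => i; rewrite /y /w /v !mxE; ring.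
have := dot_perturbed_lower y w v _ hyv.
move: hlt yqb hv hw ha hb tab; move: s0 t0 (normr_ge0 (1 - theta)).
have := enorm_ge0 qa; have := enorm_ge0 qb; have := enorm_ge0 e.
have := enorm_ge0 Delta; have := enorm_ge0 wa; have := enorm_ge0 wb.
move: (enorm qa) (enorm qb) (enorm wa) (enorm wb) (enorm e) (enorm Delta).
move: (enorm y) (enorm w) (enorm v) `|1 - theta|; clear.
move=> y w v t ra rb oa ob e D ob0 oa0 D0 e0 rb0 ra0 s0 th0 t0 hlt yqb hv hw ha hb tab.
have tra : 0 <= t * ra by rewrite mulr_ge0.
have tsra : 0 <= theta * (sigma * ra - oa) by rewrite mulr_ge0 // subr_ge0.
have B0 : 0 <= sigma * rb + theta * (sigma * ra).
  by rewrite addr_ge0 ?mulr_ge0.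
(* What the proximal residuals leave of their tolerances. *)
pose A := (sigma * rb - ob) + theta * (sigma * ra - oa).
have A0 : 0 <= A by rewrite addr_ge0 // subr_ge0.
have yv : sigma * rb + theta * (sigma * ra) < y - v by lra.
have yw : A < y - w.
  by rewrite /A; lra.
move=> hlow; have wvy : w + v <= y by lra.
have := hlow wvy; rewrite leNgt => /negP; apply.
apply: le_lt_trans (_ : A * (sigma * rb + theta * (sigma * ra)) < _); last first.
  by rewrite ltr_pM.
rewrite /A.
have q1 : 0 <= (sigma * rb - ob) ^+ 2 by rewrite sqr_ge0.
have q2 : 0 <= theta * (sigma * ra - oa) ^+ 2 by rewrite mulr_ge0 // sqr_ge0.
have q3 : 0 <= (sigma * rb - ob) * (theta * (sigma * ra)).
  by rewrite mulr_ge0 ?subr_ge0 // !mulr_ge0.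
case: tab => tab.
  have q4 : 0 <= theta * (sigma * ra - oa) * (sigma * ra) * (theta - 1).
    by apply: mulr_ge0; rewrite ?subr_ge0 // mulr_ge0 // mulr_ge0.
  have q5 : 0 <= theta * (sigma * ra - oa) * (sigma * rb).
    by rewrite mulr_ge0 // mulr_ge0.
  by lra.
have q4 : 0 <= theta * (sigma * ra - oa) * (sigma * (rb - ra)).
  by rewrite mulr_ge0 // mulr_ge0 // subr_ge0.
have q5 : 0 <= theta * (sigma * ra - oa) * (theta * (sigma * ra)).
  by rewrite mulr_ge0 // mulr_ge0 // mulr_ge0.
by lra.
Qed.
End Compare.

(** * Approximate Newton solutions *)

Section Newton.
Context {R : realType} {d : nat}.
Variables (p : params R) (P : problem R d).
Hypotheses (hp : params_ok p) (Pok : problem_ok P).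
Implicit Types (x y : 'rV[R]_d) (delta lambda : R) (t : triple R d).

Lemma model_gradient_error delta x y : 0 < delta ->
  enorm (gradient (g P) y - (gradient (g P) x + (y - x) *m H P delta x))
    <= delta * enorm (y - x) + L2 P / 2 * enorm (y - x) ^+ 2.
Proof.
move=> d0; have [_ ddg _] := g_C2 Pok.
have tay := taylor_lipschitz_jacobian (gradient (g P)) (L2 P) x y
  (ltW (L2_gt0 Pok)) ddg (g_hess_lip Pok).
have -> : gradient (g P) y - (gradient (g P) x + (y - x) *m H P delta x)
  = - ((y - x) *m (H P delta x - hessian (g P) x))
    + (gradient (g P) y - gradient (g P) x - (y - x) *m hessian (g P) x).
  rewrite mulmxBr; apply/rowP => i; rewrite !mxE; ring.
rewrite (le_trans (enormD _ _)) // lerD // enormN (le_trans (opnorm_le _ _)) //.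
by rewrite ler_wpM2r ?enorm_ge0 // ltW // H_close.
Qed.

Lemma ANS_enorm_le delta lambda x t : 0 < lambda -> ANS p P delta lambda x t ->
  enorm (lambda *: du t + pt t - x) <= hsigma p * enorm (pt t - x).
Proof.
move=> l0 [e0 _ hA]; have s0 := ltW (hsigma_gt0 hp).
rewrite -(@ler_pXn2r _ 2) ?nnegrE ?mulr_ge0 ?enorm_ge0 // exprMn.
by rewrite (le_trans _ hA) // lerDl !mulr_ge0 // ltW.
Qed.

(** Monotonicity of the operator of the [b]-subproblem is used between the two
solutions, so [ua] has to be corrected by the difference [e] of the two model
gradients at [pt ta].  That difference is a Taylor remainder in the move of the
centre plus the variation of the Hessian over the displacement of [ta]. *)
Lemma ANS_compare delta la lb xa xb ta tb :
  0 < delta -> 0 < la -> 0 < lb ->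
  ANS p P delta la xa ta -> ANS p P delta lb xb tb ->
  la <= lb \/ enorm (pt ta - xa) <= enorm (pt tb - xb) ->
  forall D, D = enorm (xa - xb) ->
  (1 - hsigma p) * enorm (pt tb - xb)
    <= (`|1 - lb / la| + (1 + hsigma p) * (lb / la)) * enorm (pt ta - xa)
       + lb * D * (2 * delta + L2 P * D + 2 * L2 P * enorm (pt ta - xa)) + D.
Proof.
move=> d0 la0 lb0 Aa Ab tab D DE.
have s0 := ltW (hsigma_gt0 hp).
have wa := ANS_enorm_le delta la xa ta la0 Aa; have wb := ANS_enorm_le delta lb xb tb lb0 Ab.
have [ea0 [va hva ua] ha] := Aa; have [eb0 [vb hvb ub] hb] := Ab.
rewrite gradient_gmodel // in ua; rewrite gradient_gmodel // in ub.
pose qa := pt ta - xa; pose qb := pt tb - xb.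
pose e := gradient (g P) xa + qa *m H P delta xa
          - (gradient (g P) xb + (pt ta - xb) *m H P delta xb).
have he : enorm e <= D * (delta + L2 P / 2 * D + L2 P * enorm qa).
  have -> : e = qa *m (H P delta xa - H P delta xb)
     + (gradient (g P) xa - (gradient (g P) xb + (xa - xb) *m H P delta xb)).
    rewrite /e; have -> : pt ta - xb = qa + (xa - xb) by rewrite addrA subrK.
    rewrite [(qa + _) *m _]mulmxDl mulmxBr.
    move: (qa *m H P delta xa) (qa *m H P delta xb) ((xa - xb) *m H P delta xb).
    by move=> u v w; apply/rowP => i; rewrite !mxE; ring.
  rewrite (le_trans (enormD _ _)) //.
  have := model_gradient_error delta xb xa d0; rewrite -DE => h1.
  have h2 := opnorm_le (H P delta xa - H P delta xb) qa.
  have := ler_wpM2r (enorm_ge0 qa) (H_lip Pok xa xb d0); rewrite -DE => h3.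
  by lra.
pose T := lb / la.
have T0 : 0 < T by rewrite divr_gt0.
have lbE : lb = T * la by rewrite /T divfK // gt_eqF.
have := inexact_resolvent_compare (hsigma p) T qa qb
  (la *: du ta + pt ta - xa) (lb *: du tb + pt tb - xb) (lb *: e) (xa - xb)
  s0 (ltW T0) wa wb.
rewrite enormZ (gtr0_norm lb0) -DE => main.
apply: le_trans (main _ _) _.
- case: tab => tab; [left|by right].
  by rewrite /T ler_pdivlMr // mul1r.
- have mono : - (err ta + err tb) <= dot (va - vb) (pt ta - pt tb).
    have := hva (pt tb); have := hvb (pt ta).
    by rewrite [dot (va - vb) _]dotC !dotE; lra.
  have psdH : 0 <= dot ((pt ta - pt tb) *m H P delta xb) (pt ta - pt tb).
    by have [_ ->] := H_psd Pok xb d0.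
  have -> : qa - qb + (xa - xb) = pt ta - pt tb.
    by apply/rowP => i; rewrite !mxE; ring.
  have -> : T *: (la *: du ta + pt ta - xa - qa) - lb *: e
    - (lb *: du tb + pt tb - xb - qb)
    = lb *: ((pt ta - pt tb) *m H P delta xb + (va - vb)).
    have -> : la *: du ta + pt ta - xa - qa = la *: du ta.
      by apply/rowP => i; rewrite !mxE; ring.
    have -> : lb *: du tb + pt tb - xb - qb = lb *: du tb.
      by apply/rowP => i; rewrite !mxE; ring.
    rewrite scalerA -lbE -!scalerBr; congr (_ *: _).
    rewrite ua ub /e -/qa; move: (qa *m H P delta xa) => qH.
    rewrite !mulmxBl; move: qH.
    move: (pt ta *m H P delta xb) (pt tb *m H P delta xb) (xb *m H P delta xb).
    by move=> u v w z; apply/rowP => i; rewrite !mxE; ring.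
  rewrite dotZl dotDl.
  set dH := dot (_ *m _) _ in psdH *; set dv := dot _ _ in mono *.
  have : 0 <= lb * dH by rewrite mulr_ge0 // ltW.
  have : lb * - (err ta + err tb) <= lb * dv by rewrite ler_pM2l.
  have := ler_wpM2l (ltW T0) ha.
  have -> : T * (hsigma p ^+ 2 * enorm (pt ta - xa) ^+ 2) =
    T * (hsigma p * enorm qa) ^+ 2 by rewrite exprMn.
  rewrite mulrDr; have -> : T * (2 * la * err ta) = 2 * lb * err ta.
    by rewrite lbE; ring.
  have := hb; rewrite -exprMn -/qb.
  set oa := enorm _ ^+ 2; set ob := enorm _ ^+ 2; set ra := (_ ^+ 2); set rb := (_ ^+ 2).
  move: (T) (dH) (dv) (ra) (rb) (oa) (ob) (err ta) (err tb); clear => *; lra.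
rewrite -/qa lerD2r -addrA lerD2l.
by have := ler_wpM2l (ltW lb0) he; move: (enorm e) (enorm qa); clear => *; lra.
Qed.

End Newton.

(** * Displacements and stepsizes *)

Section Stepsize.
Context {R : realType} {d : nat}.
Variables (p : params R) (P : problem R d).
Hypotheses (hp : params_ok p) (Pok : problem_ok P).
Implicit Types (x y : 'rV[R]_d) (delta lambda : R) (t : triple R d).

(** When the stepsize shrinks, the displacement of the [b]-solution is either
already below that of [a], or the comparison applies with a ratio at most 1. *)
Lemma ANS_shorter_step delta la lb xa xb ta tb D :
  0 < delta -> 0 < lb -> lb <= la ->
  ANS p P delta la xa ta -> ANS p P delta lb xb tb ->
  D = enorm (xa - xb) ->
  (1 - hsigma p) * enorm (pt tb - xb)
    <= (1 + hsigma p) * enorm (pt ta - xa)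
       + lb * D * (2 * delta + L2 P * D + 2 * L2 P * enorm (pt ta - xa)) + D.
Proof.
move=> d0 lb0 lab Aa Ab DE; have s0 := hsigma_gt0 hp; have L0 := L2_gt0 Pok.
have la0 : 0 < la := lt_le_trans lb0 lab.
have D0 : 0 <= D by rewrite DE enorm_ge0.
have ra0 := enorm_ge0 (pt ta - xa); have rb0 := enorm_ge0 (pt tb - xb).
case: (leP (enorm (pt ta - xa)) (enorm (pt tb - xb))) => ab; last first.
  have : 0 <= hsigma p * enorm (pt tb - xb) by rewrite mulr_ge0 // ltW.
  have : 0 <= hsigma p * enorm (pt ta - xa) by rewrite mulr_ge0 // ltW.
  have : 0 <= lb * D * (2 * delta + L2 P * D + 2 * L2 P * enorm (pt ta - xa)).
    by rewrite mulr_ge0 // ?mulr_ge0 // ?(ltW lb0) // !addr_ge0 // ?mulr_ge0 // ?mulr_ge0 // ltW.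
  move: (enorm (pt ta - xa)) (enorm (pt tb - xb)) (lb * D * _) ab D0 => *; lra.
have tab : la <= lb \/ enorm (pt ta - xa) <= enorm (pt tb - xb) by right.
have := ANS_compare p P hp Pok delta la lb xa xb ta tb d0 la0 lb0 Aa Ab tab D DE.
move=> h; apply: le_trans h _; rewrite lerD2r lerD2r ler_wpM2r //.
have T1 : lb / la <= 1 by rewrite ler_pdivrMr // mul1r.
rewrite ger0_norm ?subr_ge0 //.
have : 0 <= hsigma p * (1 - lb / la) by rewrite mulr_ge0 ?subr_ge0 // ltW.
move: (lb / la) (hsigma p) => *; lra.
Qed.

(** The triple at [xstar] with zero dual vector and zero error is a Newton
solution centred at [xstar], at any stepsize, with zero displacement; it is
compared with [t]. *)
Lemma dist_ANS_le_minimizer delta lambda x t D :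
  0 < delta -> 0 < lambda -> ANS p P delta lambda x t ->
  D = enorm (x - xstar P) ->
  (1 - hsigma p) * enorm (pt t - x)
    <= D * (1 + 2 * (lambda * delta) + L2 P * lambda * D).
Proof.
move=> d0 l0 At DE.
have As : ANS p P delta lambda (xstar P) (Triple (xstar P) 0 0).
  split => //=.
    exists (- gradient (g P) (xstar P)); first exact: minimizer_subgradient.
    by rewrite gradient_gmodel // subrr mul0mx addr0 subrr.
  by rewrite scaler0 add0r subrr enorm0 expr0n !mulr0 addr0.
have tab : lambda <= lambda \/ enorm (xstar P - xstar P) <= enorm (pt t - x) by left.
rewrite enormB in DE.
have := ANS_compare p P hp Pok delta _ _ _ _ _ _ d0 l0 l0 As At tab D DE.
rewrite /= subrr enorm0; move: (enorm _) (lambda / lambda) => *; lra.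
Qed.

Lemma residual_le delta lambda x t : 0 < delta -> 0 < lambda ->
  ANS p P delta lambda x t ->
  lambda * enorm (residual P delta x t)
    <= (lambda * delta + 1 + hsigma p) * enorm (pt t - x)
       + lambda * L2 P / 2 * enorm (pt t - x) ^+ 2.
Proof.
move=> d0 l0 At; have := ANS_enorm_le p P hp _ _ _ _ l0 At.
have := model_gradient_error P Pok delta x (pt t) d0.
rewrite /residual gradient_gmodel //.
set e := _ - _ => he hw.
have hu : lambda * enorm (du t) <= (1 + hsigma p) * enorm (pt t - x).
  rewrite -{1}(gtr0_norm l0) -enormZ.
  have -> : lambda *: du t = (lambda *: du t + pt t - x) + - (pt t - x).
    by rewrite -[_ + pt t - x]addrA addrK.
  rewrite (le_trans (enormD _ _)) // enormN; move: (enorm _) (enorm _) hw => *; lra.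
have := ler_wpM2l (ltW l0) (enormD e (du t)).
have := ler_wpM2l (ltW l0) he.
move: (enorm e) (enorm (du t)) (enorm (e + du t)) (enorm (pt t - x)) hu; clear => *; lra.
Qed.

(** With [s = L2 * lambda * |y - x| < 2], the residual is at most a constant
times [s / (L2 * lambda ^ 2)] and the error at most a constant times
[s ^ 2 / (L2 ^ 2 * lambda ^ 3)], so a triple that does not terminate the method
limits [L2 * lambda].  Bounding [L2 * lambda] and not [lambda] keeps negative
powers of [L2] out of the estimates. *)
Lemma small_step_stepsize_bound (rho eps : R) xt delta t :
  0 < rho -> 0 < eps -> 0 < delta ->
  computed p P rho eps delta (C p / delta) (xt (C p / delta)) t ->
  large_step xt (C p / delta) t < alpha_minus p P ->
  forall X, X = L2 P * (C p / delta) ->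
  rho * X ^+ 2 <= 8 * L2 P \/ eps * X ^+ 3 <= 8 * L2 P.
Proof.
move=> rho0 eps0 d0; rewrite /computed /large_step /alpha_minus.
have C0 := C_gt0 hp; have C1 := tsigma_lt1 hp; have sl0 := sigma_l_gt0 hp.
have slu := sigma_lu hp; have su1 := sigma_u_lt1 hp; have s0 := hsigma_gt0 hp.
have L0 := L2_gt0 Pok.
set lambda := C p / delta; set x := xt lambda; set r := enorm (pt t - x).
move=> [At hre] hs X XE.
have l0 : 0 < lambda by rewrite divr_gt0.
have ldC : lambda * delta = C p by rewrite /lambda divfK // gt_eqF.
clearbody lambda.
have r0 : 0 <= r by exact: enorm_ge0.
have := residual_le _ _ _ _ d0 l0 At; rewrite ldC -/r => hres.
have [e0 _ hA] := At; rewrite -/r in hA.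
pose s := lambda * r * L2 P.
have s2 : s < 2.
  by apply: (@lt_trans _ _ (2 * sigma_l p)); [rewrite /s -ltr_pdivlMr|lra].
have sge0 : 0 <= s by rewrite /s; do !apply: mulr_ge0 => //; exact: ltW.
have ss : s ^+ 2 <= 4.
  have : 0 <= (2 - s) * (2 + s) by apply: mulr_ge0; lra.
  by lra.
case: hre => [hrho|heps]; [left|right].
  have : rho * lambda <= lambda * enorm (residual P delta x t).
    by rewrite mulrC ler_pM2l // ltW.
  move=> /le_trans /(_ hres) /(ler_wpM2l (ltW (mulr_gt0 (mulr_gt0 l0 L0) L0))).
  have -> : lambda * L2 P * L2 P * (rho * lambda) = rho * X ^+ 2.
    by rewrite XE; ring.
  move=> h; apply: le_trans h _.
  have -> : lambda * L2 P * L2 P * ((C p + 1 + hsigma p) * r + lambda * L2 P / 2 * r ^+ 2)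
    = L2 P * ((C p + 1 + hsigma p) * s + s ^+ 2 / 2).
    by rewrite /s; ring.
  rewrite mulrC ler_pM2r //.
  have : (C p + 1 + hsigma p) * s <= 2 * 2 by rewrite ler_pM //; lra.
  by lra.
have : 2 * lambda * eps <= hsigma p ^+ 2 * r ^+ 2.
  apply: le_trans (_ : 2 * lambda * err t <= _).
    by rewrite ler_pM2l ?mulr_gt0 // ltW.
  by apply: le_trans hA; rewrite lerDr sqr_ge0.
move=> /(ler_wpM2l (ltW (mulr_gt0 (mulr_gt0 (mulr_gt0 l0 l0) (mulr_gt0 L0 L0)) L0))).
have -> : lambda * lambda * (L2 P * L2 P) * L2 P * (2 * lambda * eps)
  = 2 * (eps * X ^+ 3) by rewrite XE; ring.
have -> : lambda * lambda * (L2 P * L2 P) * L2 P * (hsigma p ^+ 2 * r ^+ 2)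
  = L2 P * (hsigma p ^+ 2 * s ^+ 2) by rewrite /s; ring.
have h1 : hsigma p ^+ 2 * s ^+ 2 <= 1 * 4.
  by rewrite ler_pM ?sqr_ge0 // expr_le1 //; lra.
have := ler_wpM2l (ltW L0) h1; lra.
Qed.

End Stepsize.

(** * The initial bracket and the shortest possible bracket *)

Section Bracket.
Context {R : realType} {d : nat}.
Variables (p : params R) (P : problem R d).
Hypotheses (hp : params_ok p) (Pok : problem_ok P).
Implicit Types (x y : 'rV[R]_d) (delta lambda : R) (t : triple R d).

Lemma alpha_minus_gt0 : 0 < alpha_minus p P.
Proof. by rewrite divr_gt0 ?L2_gt0 // mulr_gt0 ?sigma_l_gt0. Qed.

Lemma alpha_minus_lt_plus : alpha_minus p P < alpha_plus p P.
Proof. by rewrite ltr_pM2r ?invr_gt0 ?L2_gt0 // ltr_pM2l ?sigma_lu. Qed.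

Section LowerEnd.
Variables (xt : R -> 'rV[R]_d) (M1 lambda : R) (t : triple R d).
Hypotheses (l0 : 0 < lambda) (M10 : 0 < M1).
Hypothesis large : alpha_plus p P < large_step xt lambda t.

Definition lambda_minus0_den : R :=
  (1 + hsigma p) * (1 + 2 * L2 P * gamma0 xt M1 lambda) * large_step xt lambda t
  + (1 + 2 * C p) * gamma0 xt M1 lambda + L2 P * gamma0 xt M1 lambda ^+ 2.

Lemma gamma0_ge0 : 0 <= gamma0 xt M1 lambda.
Proof. by rewrite !mulr_ge0 ?enorm_ge0 // ltW. Qed.

Lemma lambda_minus0_den_ge : large_step xt lambda t <= lambda_minus0_den.
Proof.
have s0 := hsigma_gt0 hp; have C0 := C_gt0 hp; have L0 := L2_gt0 Pok.
have s0' : 0 <= large_step xt lambda t by rewrite mulr_ge0 ?enorm_ge0 // ltW.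
have G0 := gamma0_ge0; rewrite /lambda_minus0_den.
have h1 : 0 <= L2 P * gamma0 xt M1 lambda by rewrite mulr_ge0 // ltW.
have h2 : 0 <= L2 P * gamma0 xt M1 lambda ^+ 2 by rewrite mulr_ge0 ?sqr_ge0 // ltW.
have h3 : 0 <= C p * gamma0 xt M1 lambda by rewrite mulr_ge0 // ltW.
have h4 : 1 <= (1 + hsigma p) * (1 + 2 * (L2 P * gamma0 xt M1 lambda)).
  by rewrite -[1]mul1r ler_pM //; lra.
have := ler_wpM2r s0' h4.
by move: (gamma0 _ _ _) (large_step _ _ _) G0 h1 h2 h3 => *; lra.
Qed.

Lemma lambda_minus0_den_gt0 : 0 < lambda_minus0_den.
Proof.
apply: lt_le_trans lambda_minus0_den_ge; apply: lt_trans large.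
exact: lt_trans alpha_minus_gt0 alpha_minus_lt_plus.
Qed.

Lemma lambda_minus0_denE :
  lambda_minus0 p P xt M1 lambda t * lambda_minus0_den
  = (1 - hsigma p) * alpha_minus p P * lambda.
Proof.
have := lambda_minus0_den_gt0; rewrite /lambda_minus0_den /large_step mulrA.
by move=> /gt_eqF/negbT/divfK; exact.
Qed.

Lemma lambda_minus0_gt0 : 0 < lambda_minus0 p P xt M1 lambda t.
Proof.
rewrite -(pmulr_lgt0 _ lambda_minus0_den_gt0) lambda_minus0_denE.
by rewrite mulr_gt0 // mulr_gt0 ?alpha_minus_gt0 // subr_gt0 hsigma_lt1.
Qed.

Lemma lambda_minus0_lt : lambda_minus0 p P xt M1 lambda t < lambda.
Proof.
rewrite -(ltr_pM2r lambda_minus0_den_gt0) lambda_minus0_denE mulrC ltr_pM2l //.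
apply: lt_le_trans lambda_minus0_den_ge; apply: lt_trans large.
apply: le_lt_trans alpha_minus_lt_plus.
by rewrite ler_piMl // ?(ltW alpha_minus_gt0) // lerBlDr lerDl ltW ?hsigma_gt0.
Qed.

(** The denominator of [lambda_minus0] dominates [lambda] times the right-hand
side of [ANS_shorter_step], the move of the centre being at most
[gamma0 / lambda]. *)
Lemma lambda_minus0_small_step delta t_minus0 :
  let lminus := lambda_minus0 p P xt M1 lambda t in
  0 < delta -> lambda * delta = C p ->
  ANS p P delta lambda (xt lambda) t ->
  ANS p P delta lminus (xt lminus) t_minus0 ->
  enorm (xt lambda - xt lminus) <= M1 * enorm (xt lambda - xt 0) ->
  large_step xt lminus t_minus0 <= alpha_minus p P.
Proof.
move=> lm d0 ldC At Am; set D := enorm (xt lambda - xt lm) => hD.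
have lm0 : 0 < lm := lambda_minus0_gt0.
have lml : lm < lambda := lambda_minus0_lt.
have s0 := hsigma_gt0 hp; have s1 := hsigma_lt1 hp; have L0 := L2_gt0 Pok.
have C0 := C_gt0 hp; have G0 := gamma0_ge0.
have D0 : 0 <= D := enorm_ge0 _.
have lDG : lambda * D <= gamma0 xt M1 lambda.
  by rewrite /gamma0 -mulrA mulrCA ler_pM2l.
have S0 : 0 <= large_step xt lambda t by rewrite mulr_ge0 ?enorm_ge0 // ltW.
have := ANS_shorter_step p P hp Pok delta lambda lm _ _ _ _ D d0 lm0 (ltW lml) At Am erefl.
move=> /(ler_wpM2l (ltW l0)) h.
suff h2 : lambda * ((1 - hsigma p) * enorm (pt t_minus0 - xt lm)) <= lambda_minus0_den.
  have := ler_wpM2l (ltW lm0) h2; rewrite lambda_minus0_denE -/lm.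
  have -> : lm * (lambda * ((1 - hsigma p) * enorm (pt t_minus0 - xt lm)))
    = (1 - hsigma p) * lambda * (lm * enorm (pt t_minus0 - xt lm)) by ring.
  by rewrite [X in _ <= X]mulrAC ler_pM2l // mulr_gt0 // subr_gt0.
apply: le_trans h _; rewrite /lambda_minus0_den.
have e1 : lambda * ((1 + hsigma p) * enorm (pt t - xt lambda)
     + lm * D * (2 * delta + L2 P * D + 2 * L2 P * enorm (pt t - xt lambda)) + D)
  = (1 + hsigma p) * large_step xt lambda t
    + lm * D * (2 * C p + L2 P * (lambda * D) + 2 * L2 P * large_step xt lambda t)
    + lambda * D by rewrite -ldC /large_step; ring.
rewrite e1; move: S0 lDG G0; move: (large_step _ _ _) (gamma0 _ _ _) => S G S0 lDG G0.
have h3 : lm * D <= G by apply: le_trans lDG; rewrite ler_wpM2r // ltW.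
have lD0 : 0 <= lambda * D by rewrite mulr_ge0 // ltW.
have h4 : lm * D * (2 * C p + L2 P * (lambda * D) + 2 * L2 P * S)
  <= G * (2 * C p + L2 P * G + 2 * L2 P * S).
  have q1 : 0 <= L2 P * (lambda * D) by rewrite mulr_ge0 // ltW.
  have q2 : 0 <= L2 P * S by rewrite mulr_ge0 // ltW.
  have q3 : L2 P * (lambda * D) <= L2 P * G by rewrite ler_pM2l.
  rewrite ler_pM //; last lra.
    by rewrite mulr_ge0 // ltW.
  by lra.
have h5 : 0 <= hsigma p * (L2 P * G) * S.
  by do !apply: mulr_ge0 => //; exact: ltW.
by lra.
Qed.

End LowerEnd.

(** The room left by the condition on [sigma_l], [sigma_u] and [hsigma]; the
error terms of [bracket_gap] add up to at most 28 times this, against twice the room,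
whence the 14. *)
Definition gap_const : R :=
  ((1 - hsigma p) * sigma_u p - (1 + hsigma p) * sigma_l p) / 14.

Lemma gap_const_gt0 : 0 < gap_const.
Proof. by rewrite divr_gt0 // subr_gt0; have := sigma_gap hp; lra. Qed.

Lemma gap_const_le1 : gap_const <= 1.
Proof.
rewrite ler_pdivrMr // mul1r.
have s0 := hsigma_gt0 hp; have s1 := hsigma_lt1 hp; have l0 := sigma_l_gt0 hp.
have lu := sigma_lu hp; have u1 := sigma_u_lt1 hp.
have h1 : 0 <= hsigma p * sigma_u p by rewrite mulr_ge0 //; lra.
have h2 : 0 <= hsigma p * sigma_l p by rewrite mulr_ge0 //; lra.
lra.
Qed.

(** If the relative length [tau] of the bracket and the scaled move
[q = L2 * lb * D] of the centre were both below [gap_const], then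
[ANS_compare] would put [(1 - hsigma) * 2 * sigma_u] below
[(1 + hsigma) * 2 * sigma_l + 16 * tau + 12 * q], against the choice of
[gap_const]. *)
Lemma bracket_gap delta la lb xa xb ta tb M0 :
  0 < delta -> 0 < la -> la < lb -> lb * delta <= C p -> 0 < M0 ->
  ANS p P delta la xa ta -> ANS p P delta lb xb tb ->
  enorm (xa - xb) <= M0 / la * (lb - la) ->
  la * enorm (pt ta - xa) <= alpha_minus p P ->
  alpha_plus p P < lb * enorm (pt tb - xb) ->
  gap_const <= (lb - la) / la * (1 + L2 P * lb * M0).
Proof.
move=> d0 la0 lab ldC M00 Aa Ab; set D := enorm _ => hD ha hb.
rewrite leNgt; apply/negP => hgap.
have s0 := hsigma_gt0 hp; have s1 := hsigma_lt1 hp; have L0 := L2_gt0 Pok.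
have C0 := C_gt0 hp; have D0 : 0 <= D := enorm_ge0 _.
have sl0 := sigma_l_gt0 hp; have slu := sigma_lu hp; have su1 := sigma_u_lt1 hp.
have C1 : C p <= 1 by have := tsigma_lt1 hp; lra.
have lb0 := lt_trans la0 lab; have k1 := gap_const_le1.
have tab : la <= lb \/ enorm (pt ta - xa) <= enorm (pt tb - xb) by left; exact: ltW.
have := ANS_compare p P hp Pok delta la lb xa xb ta tb d0 la0 lb0 Aa Ab tab D erefl.
move=> /(ler_wpM2l (mulr_ge0 (ltW L0) (ltW lb0))).
pose tau := (lb - la) / la; pose q := L2 P * lb * D.
have tau0 : 0 < tau by rewrite divr_gt0 // subr_gt0.
have lbE : lb / la = 1 + tau by rewrite /tau mulrBl divff ?gt_eqF // addrCA subrr addr0.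
have lbE' : lb = (1 + tau) * la by rewrite -lbE divfK // gt_eqF.
have normT : `|1 - (1 + tau)| = tau.
  by rewrite opprD addrA subrr add0r normrN gtr0_norm.
rewrite lbE normT.
pose Q := L2 P * lb * M0.
have Q0 : 0 <= Q by do !apply: mulr_ge0 => //; exact: ltW.
have q0 : 0 <= q by do !apply: mulr_ge0 => //; exact: ltW.
have qQ : q <= tau * Q.
  have -> : tau * Q = L2 P * lb * (M0 / la * (lb - la)) by rewrite /Q /tau; ring.
  by rewrite ler_pM2l // mulr_gt0.
rewrite -/tau -/Q in hgap.
have tQ0 : 0 <= tau * Q by rewrite mulr_ge0 // ltW.
have tk : tau < gap_const by lra.
have qk : q < gap_const by lra.
pose ra := L2 P * (la * enorm (pt ta - xa)).
pose rb := L2 P * (lb * enorm (pt tb - xb)).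
have rasl : ra <= 2 * sigma_l p.
  have -> : 2 * sigma_l p = L2 P * alpha_minus p P by rewrite [RHS]mulrC divfK // gt_eqF.
  by rewrite ler_pM2l.
have rbsu : 2 * sigma_u p < rb.
  have -> : 2 * sigma_u p = L2 P * alpha_plus p P by rewrite [RHS]mulrC divfK // gt_eqF.
  by rewrite ltr_pM2l.
have ra0 : 0 <= ra by do !apply: mulr_ge0 => //; rewrite ?enorm_ge0 // ltW.
have -> : L2 P * lb * ((1 - hsigma p) * enorm (pt tb - xb)) = (1 - hsigma p) * rb.
  by rewrite /rb; ring.
have -> : L2 P * lb * ((tau + (1 + hsigma p) * (1 + tau)) * enorm (pt ta - xa)
    + lb * D * (2 * delta + L2 P * D + 2 * L2 P * enorm (pt ta - xa)) + D)
  = (tau + (1 + hsigma p) * (1 + tau)) * (1 + tau) * ra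
    + q * (2 * (lb * delta) + q + 2 * (1 + tau) * ra) + q.
  rewrite /q /ra; move: (enorm (pt ta - xa)) (hsigma p) (L2 P) (D) (tau) lbE'.
  by move=> r s L D' t ->; ring.
have tau1 : tau <= 1 by lra.
have t2 : tau ^+ 2 <= tau by rewrite expr2 ler_piMl // ltW.
have st : hsigma p * tau <= tau by rewrite ler_piMl // ltW.
have st2 : hsigma p * tau ^+ 2 <= tau ^+ 2 by rewrite ler_piMl ?sqr_ge0 // ltW.
have c1 : (tau + (1 + hsigma p) * (1 + tau)) * (1 + tau) <= 1 + hsigma p + 8 * tau by lra.
have c2 := ler_wpM2r ra0 c1.
have r1 : (1 + hsigma p) * ra <= (1 + hsigma p) * (2 * sigma_l p).
  by rewrite ler_wpM2l //; lra.
have r2 : tau * ra <= tau * 2 by rewrite ler_wpM2l //; lra.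
have r3 : (1 + tau) * ra <= 2 * 2 by rewrite ler_pM //; lra.
have c3 : q * (2 * (lb * delta) + q + 2 * (1 + tau) * ra) <= q * 11.
  by rewrite ler_wpM2l //; lra.
have c4 : (1 - hsigma p) * (2 * sigma_u p) < (1 - hsigma p) * rb.
  by rewrite ltr_pM2l // subr_gt0.
have kE : 14 * gap_const = (1 - hsigma p) * sigma_u p - (1 + hsigma p) * sigma_l p.
  by rewrite /gap_const [LHS]mulrC divfK // pnatr_eq0.
by lra.
Qed.

End Bracket.

(** * The curve *)

Section Curve.
Context {R : realType} {d : nat}.

Lemma curve_convex A (x y : 'rV[R]_d) lambda : 0 <= A -> 0 <= lambda ->
  exists2 a : R, 0 <= a <= 1 & curve A x y lambda = y + a *: (x - y).
Proof.
move=> A0 l0; rewrite /curve; set a := _ / 2.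
have a0 : 0 <= a by rewrite divr_ge0 // addr_ge0 // sqrtr_ge0.
case: eqP => [_|/eqP Aa]; first by exists 1; rewrite ?ler01 ?lexx // scale1r addrC subrK.
have Aa0 : 0 < A + a by rewrite lt_def Aa addr_ge0.
exists (a / (A + a)); first by rewrite divr_ge0 ?(ltW Aa0) // ler_pdivrMr // mul1r lerDr.
have -> : A / (A + a) = 1 - a / (A + a) by field.
by rewrite scalerBl scale1r scalerBr -addrA; congr (_ + _); rewrite addrC.
Qed.

(** The weight [a] is the nonnegative root of [a ^ 2 = lambda * (A + a)], so the
curve is explicit in terms of [a]. *)
Lemma curveE A (x y : 'rV[R]_d) a : 0 < A -> 0 <= a ->
  curve A x y (a ^+ 2 / (A + a)) = y + (a / (A + a)) *: (x - y).
Proof.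
move=> A0 a0; have Aa0 : 0 < A + a by lra.
set l := a ^+ 2 / (A + a); rewrite /curve.
have la : l <= a by rewrite ler_pdivrMr // expr2 ler_wpM2l // lerDr ltW.
have -> : l ^+ 2 + 4 * l * A = (2 * a - l) ^+ 2.
  by rewrite /l; field; rewrite gt_eqF.
rewrite sqrtr_sqr ger0_norm; last lra.
have -> : (l + (2 * a - l)) / 2 = a by field.
rewrite gt_eqF //; have -> : A / (A + a) = 1 - a / (A + a).
  by field; rewrite gt_eqF.
by rewrite scalerBl scale1r scalerBr -addrA; congr (_ + _); rewrite addrC.
Qed.

(** The curve stays on the segment from [y] to [x].  At [A / 2] and [4 / 3 * A],
where [a] equals [A] and [2 * A], it is at the fractions 1 / 2 and 2 / 3 of that
segment, so the Lipschitz hypothesis between these two points bounds the length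
of the segment. *)
Lemma curve_dist0_le A (x y : 'rV[R]_d) (M0 lambda : R) :
  0 <= A -> 0 < M0 -> 0 < lambda ->
  (forall s r, 0 < r -> r <= s ->
     enorm (curve A x y s - curve A x y r) <= M0 / r * (s - r)) ->
  enorm (curve A x y lambda - curve A x y 0) <= 10 * M0.
Proof.
rewrite le_eqVlt => /orP[/eqP <-|A0] M00 l0 lip.
  have c0 l : 0 <= l -> curve 0 x y l = x.
    move=> l'0; rewrite /curve mulr0 addr0 sqrtr_sqr ger0_norm // add0r mul0r scale0r add0r.
    have -> : (l + l) / 2 = l by field.
    by case: eqP => // /eqP l1; rewrite divff // scale1r.
  rewrite !c0 ?(ltW l0) // subrr enorm0; lra.
have c0 : curve A x y 0 = y.
  have := curveE A x y 0 A0 (lexx 0).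
  by rewrite expr0n /= !mul0r scale0r addr0.
have cA : curve A x y (A / 2) = y + 2^-1 *: (x - y).
  have := curveE A x y A A0 (ltW A0).
  have -> : A ^+ 2 / (A + A) = A / 2 by field; rewrite gt_eqF //; lra.
  by have -> : A / (A + A) = 2^-1 by field; rewrite gt_eqF //; lra.
have c2A : curve A x y (4 / 3 * A) = y + (2 / 3) *: (x - y).
  have := curveE A x y (2 * A) A0.
  have -> : (2 * A) ^+ 2 / (A + 2 * A) = 4 / 3 * A by field; rewrite gt_eqF //; lra.
  have -> : 2 * A / (A + 2 * A) = 2 / 3 by field; rewrite gt_eqF //; lra.
  by apply; lra.
have xy : enorm (x - y) <= 10 * M0.
  have := lip (4 / 3 * A) (A / 2).
  rewrite c2A cA opprD addrACA subrr add0r -scalerBl enormZ.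
  have -> : M0 / (A / 2) * (4 / 3 * A - A / 2) = 5 / 3 * M0.
    by field; rewrite gt_eqF.
  rewrite ger0_norm; last lra.
  have h1 : 0 < A / 2 by lra.
  have h2 : A / 2 <= 4 / 3 * A by lra.
  by move=> /(_ h1 h2); lra.
have [a /andP[a0 a1] ->] := curve_convex A x y lambda (ltW A0) (ltW l0).
rewrite c0 addrC addKr enormZ ger0_norm //.
by apply: le_trans xy; rewrite ler_piMl ?enorm_ge0.
Qed.

End Curve.

(** * Bounds by powers of a single number *)

Section PowerBounds.
Context {R : realType} {Z : R}.
Hypothesis Z3 : 3 <= Z.

Let Z1 : 1 <= Z. Proof. by apply: le_trans Z3; rewrite ler1n. Qed.

Lemma le_powD (a b : R) m n :
  a <= Z ^+ m -> b <= Z ^+ n -> a + b <= Z ^+ (maxn m n).+1.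
Proof.
move=> am bn; have mle := ler_weXn2l Z1 (leq_maxl m n).
have nle := ler_weXn2l Z1 (leq_maxr m n).
have : 0 <= Z ^+ maxn m n by rewrite exprn_ge0 // (le_trans ler01).
rewrite exprS; set z := Z ^+ maxn m n in mle nle * => z0.
have := ler_wpM2r z0 Z3; lra.
Qed.

Lemma le_powM (a b : R) m n : 0 <= a -> 0 <= b ->
  a <= Z ^+ m -> b <= Z ^+ n -> a * b <= Z ^+ (m + n).
Proof. by move=> *; rewrite exprD ler_pM. Qed.

End PowerBounds.

(** * The search for the accuracy *)

Section Search.
Context {R : realType} {d : nat}.
Variables (p : params R) (P : problem R d).
Hypotheses (hp : params_ok p) (Pok : problem_ok P).
Implicit Types (x y : 'rV[R]_d) (delta lambda : R) (t : triple R d).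

Lemma small_step_stepsize_le (rho eps B : R) xt delta t :
  0 < rho -> 0 < eps -> 0 < delta ->
  1 <= B -> L2 P <= B -> rho^-1 <= B -> eps^-1 <= B ->
  computed p P rho eps delta (C p / delta) (xt (C p / delta)) t ->
  large_step xt (C p / delta) t < alpha_minus p P ->
  L2 P * (C p / delta) <= 8 * B ^+ 2.
Proof.
move=> rho0 eps0 d0 B1 LB rB eB At ht.
have L0 := L2_gt0 Pok.
have := small_step_stepsize_bound p P hp Pok rho eps xt delta t rho0 eps0 d0 At ht _ erefl.
set X := L2 P * _ => hX.
have B2 : 1 <= B ^+ 2 by rewrite expr_ge1 // (le_trans ler01).
have hinv (c b : R) : 0 < c -> c^-1 <= B -> c * b <= 8 * L2 P -> b <= 8 * B ^+ 2.
  move=> c0 cB cb; rewrite -[b](mulKf (lt0r_neq0 c0)).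
  rewrite (le_trans (ler_wpM2l _ cb)) ?invr_ge0 ?(ltW c0) //.
  rewrite mulrCA ler_pM2l // expr2 ler_pM // ?invr_ge0 ltW //.
have X2 : X ^+ 2 <= 8 * B ^+ 2 \/ X ^+ 3 <= 8 * B ^+ 2.
  by case: hX => hX; [left; apply: hinv hX|right; apply: hinv hX].
rewrite leNgt; apply/negP => XB; have X1 : 1 <= X by lra.
have X0 : 0 < X by lra.
have XX2 : X <= X ^+ 2 by rewrite expr2 ler_peMl // ltW.
have X23 : X ^+ 2 <= X ^+ 3 by rewrite [X ^+ 3]exprS ler_peMl // exprn_ge0 // ltW.
case: X2; lra.
Qed.

Lemma delta_search_lower (rho eps B W : R) xt delta delta' t :
  0 < rho -> 0 < eps ->
  1 <= B -> L2 P <= B -> rho^-1 <= B -> eps^-1 <= B ->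
  gamma p * (8 * B ^+ 2) <= W ->
  delta_search p P rho eps xt delta delta' t ->
  0 < delta -> L2 P * (C p / delta) <= W ->
  [/\ 0 < delta', L2 P * (C p / delta') <= W
    & computed p P rho eps delta' (C p / delta') (xt (C p / delta')) t].
Proof.
move=> rho0 eps0 B1 LB rB eB hW; have g0 : 0 < gamma p.
  by apply: lt_trans (gamma_gt1 hp).
elim => [{}delta {}t At _ //|{}delta {}t del' t' At small _ IH] d0 dW.
apply: IH; first by rewrite divr_gt0.
have := small_step_stepsize_le rho eps B xt delta t rho0 eps0 d0 B1 LB rB eB At small.
rewrite -(ler_pM2l g0) => /le_trans /(_ hW); apply: le_trans.
rewrite le_eqVlt; apply/orP; left; apply/eqP; field.
by rewrite !gt_eqF.
Qed.

(** The invariant [L2 * (C / delta j) <= W] holds initially, is kept by an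
increase of the accuracy parameter or its truncation at [delta_max], and is
re-established by each division, which follows a small step. *)
Lemma accuracy_lower (rho eps B W : R) (xt : nat -> R -> 'rV[R]_d)
    (delta : nat -> R) (t : nat -> triple R d) (k : nat) :
  0 < rho -> 0 < eps ->
  1 <= B -> L2 P <= B -> rho^-1 <= B -> eps^-1 <= B ->
  gamma p * (8 * B ^+ 2) <= W -> L2 P * (C p / delta_init p) <= W ->
  delta 0%N = delta_init p ->
  (forall j : nat, (j <= k)%N ->
     delta_search p P rho eps (xt j)
       (Num.min (gamma p * delta j) (delta_max p)) (delta j.+1) (t j)) ->
  forall j, (j <= k)%N ->
  [/\ 0 < delta j.+1, L2 P * (C p / delta j.+1) <= W
    & computed p P rho eps (delta j.+1) (C p / delta j.+1)
        (xt j (C p / delta j.+1)) (t j)].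
Proof.
move=> rho0 eps0 B1 LB rB eB hW hW' dE hs.
have i0 := delta_init_gt0 hp; have im := delta_init_max hp.
have g1 := gamma_gt1 hp; have C0 := C_gt0 hp; have L0 := L2_gt0 Pok.
have step j : (j <= k)%N -> 0 < delta j -> L2 P * (C p / delta j) <= W ->
  [/\ 0 < delta j.+1, L2 P * (C p / delta j.+1) <= W
    & computed p P rho eps (delta j.+1) (C p / delta j.+1)
        (xt j (C p / delta j.+1)) (t j)].
  move=> jk dj0 djW.
  apply: (delta_search_lower rho eps B W (xt j) _ _ _ rho0 eps0 B1 LB rB eB hW (hs j jk)).
    by rewrite lt_min mulr_gt0 //=; lra.
  have mono a b : 0 < a -> a <= b -> L2 P * (C p / a) <= W -> L2 P * (C p / b) <= W.
    move=> a0 ab; apply: le_trans.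
    by rewrite ler_pM2l // ler_pM2l // lef_pV2 // posrE (lt_le_trans a0).
  rewrite /Num.min; case: ifP => _.
    by apply: mono djW => //; rewrite ler_peMl // ltW.
  by apply: mono hW' => //; exact: ltW.
elim => [|j IH] jk; first by apply: step => //; rewrite dE.
by have [h1 h2 _] := IH (ltnW jk); exact: step.
Qed.

(** * The bisection *)

Section Bisection.
Variables (rho eps delta M0 M1 : R) (xt : R -> 'rV[R]_d) (t : triple R d).
Variables (t_minus0 : triple R d) (ts : nat -> triple R d).
Let lambda := C p / delta.
Let lminus := lambda_minus0 p P xt M1 lambda t.
Let mid := midpoint p P xt M1 lambda t ts.
Let acc := accepted p P xt M1 lambda t ts.
Let lo n := (bracket p P xt M1 lambda t ts n).1.
Let hi n := (bracket p P xt M1 lambda t ts n).2.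

Hypotheses (d0 : 0 < delta) (M00 : 0 < M0) (M10 : 0 < M1).
Hypothesis xt_lip : forall s r : R, 0 < r -> r <= s ->
  enorm (xt s - xt r) <= Num.min (M0 / r * (s - r)) (M1 * enorm (xt s - xt 0)).
Hypothesis At : ANS p P delta lambda (xt lambda) t.
Hypothesis large : alpha_plus p P < large_step xt lambda t.
Hypothesis Am : ANS p P delta lminus (xt lminus) t_minus0.
Hypothesis Ats : forall n, (forall i, (i < n)%N -> ~~ acc i) ->
  ANS p P delta (mid n) (xt (mid n)) (ts n).

(** At the start the upper end is large because the search was invoked, and the
lower end is small by the choice of [lambda_minus0]. *)
Lemma bracket_invariant n : (forall i, (i < n)%N -> ~~ acc i) ->
  [/\ lminus <= lo n, hi n <= lambda, (hi n - lo n) * 2 ^+ n = lambda - lminus,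
      exists2 ta, ANS p P delta (lo n) (xt (lo n)) ta
        & large_step xt (lo n) ta <= alpha_minus p P
    & exists2 tb, ANS p P delta (hi n) (xt (hi n)) tb
        & alpha_plus p P < large_step xt (hi n) tb].
Proof.
have l0 : 0 < lambda by rewrite divr_gt0 ?C_gt0.
elim: n => [_|n IH nacc].
  split; rewrite ?mulr1 //; last by exists t.
  exists t_minus0 => //.
  apply: (lambda_minus0_small_step p P hp Pok xt M1 lambda t l0 M10 large delta) => //.
    by rewrite /lambda divfK // gt_eqF.
  have := xt_lip lambda lminus (lambda_minus0_gt0 p P hp Pok xt M1 lambda t l0 M10 large)
    (ltW (lambda_minus0_lt p P hp Pok xt M1 lambda t l0 M10 large)).
  by rewrite le_min => /andP[].
have nacc' i : (i < n)%N -> ~~ acc i by move=> /ltnW; exact: nacc.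
have [hlo hhi hw hA hB] := IH nacc'; have hn := Ats n nacc'.
have l00 : 0 < lminus := lambda_minus0_gt0 p P hp Pok xt M1 lambda t l0 M10 large.
have llt : lminus < lambda := lambda_minus0_lt p P hp Pok xt M1 lambda t l0 M10 large.
have lohi : lo n < hi n.
  by rewrite -subr_gt0 -(pmulr_lgt0 _ (exprn_gt0 n (ltr0Sn R 1))) hw subr_gt0.
have midE : mid n = (lo n + hi n) / 2 by [].
have := nacc n (leqnn _); rewrite /acc /accepted -/mid.
have : bracket p P xt M1 lambda t ts n.+1 =
  if alpha_plus p P < large_step xt (mid n) (ts n) then (lo n, mid n)
  else if large_step xt (mid n) (ts n) < alpha_minus p P then (mid n, hi n)
  else (lo n, hi n).
  rewrite midE /lo /hi /=; case: (bracket _ _ _ _ _ _ _ n) => //.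
rewrite /lo /hi => -> /=; rewrite -/(lo n) -/(hi n) exprS.
case: ltP => [big _|_].
  split => //=; first by rewrite midE; lra.
    by rewrite -hw midE; field.
  by exists (ts n).
case: ltP => [small _|nsmall] //.
split => //=; first by rewrite midE; lra.
  by rewrite -hw midE; field.
by exists (ts n) => //; exact: ltW.
Qed.

Lemma bisection_count n : (forall i, (i < n)%N -> ~~ acc i) ->
  2 ^+ n * gap_const p <= lambda / lminus * (1 + L2 P * lambda * M0).
Proof.
move=> nacc; have [hlo hhi hw [ta Aa sa] [tb Ab sb]] := bracket_invariant n nacc.
have l0 : 0 < lambda by rewrite divr_gt0 ?C_gt0.
have l00 : 0 < lminus := lambda_minus0_gt0 p P hp Pok xt M1 lambda t l0 M10 large.
have llt : lminus < lambda := lambda_minus0_lt p P hp Pok xt M1 lambda t l0 M10 large.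
have pow0 : 0 < (2 : R) ^+ n by rewrite exprn_gt0.
have L0 := L2_gt0 Pok.
have lohi : lo n < hi n by rewrite -subr_gt0 -(pmulr_lgt0 _ pow0) hw subr_gt0.
have lo0 : 0 < lo n := lt_le_trans l00 hlo.
have hid : hi n * delta <= C p.
  by apply: le_trans (ler_wpM2r (ltW d0) hhi) _; rewrite /lambda divfK // gt_eqF.
have lipn : enorm (xt (lo n) - xt (hi n)) <= M0 / lo n * (hi n - lo n).
  by have := xt_lip _ _ lo0 (ltW lohi); rewrite enormB le_min => /andP[].
have := bracket_gap p P hp Pok delta (lo n) (hi n) _ _ _ _ M0 d0 lo0 lohi hid M00
  Aa Ab lipn sa sb.
move=> /(ler_wpM2l (ltW pow0)) /le_trans; apply.
rewrite mulrA ler_pM //.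
- by rewrite mulr_ge0 ?(ltW pow0) // divr_ge0 ?subr_ge0 // ltW.
- by rewrite addr_ge0 // !mulr_ge0 ?(ltW L0) ?(ltW M00) // (le_trans (ltW lo0)) // ltW.
- rewrite mulrA mulrC [2 ^+ n * _]mulrC hw mulrC.
  apply: ler_pM; rewrite ?subr_ge0 ?invr_ge0 ?(ltW llt) ?(ltW lo0) //.
    by rewrite lerBlDr lerDl ltW.
  by rewrite lef_pV2 // posrE.
by rewrite lerD2l ler_pM2r // ler_pM2l.
Qed.

End Bisection.

(** With [X = L2 * lambda <= Z ^ 3], the scaled [gamma0] is at most [Z ^ 6] and
the scaled large-step product at most [Z ^ 10]. *)
Lemma bracket_ratio_le (delta M0 M1 Z : R) xt t lambda :
  0 < delta -> lambda = C p / delta -> 0 < M0 -> 0 < M1 ->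
  ANS p P delta lambda (xt lambda) t ->
  alpha_plus p P < large_step xt lambda t ->
  enorm (xt lambda - xt 0) <= 10 * M0 ->
  10 <= Z -> (1 - hsigma p)^-1 <= Z ->
  ((1 - hsigma p) * (2 * sigma_l p))^-1 <= Z ->
  M0 <= Z -> M1 <= Z -> enorm (xt lambda - xstar P) <= Z ->
  L2 P * lambda <= Z ^+ 3 ->
  lambda / lambda_minus0 p P xt M1 lambda t <= Z ^+ 22.
Proof.
move=> d0 lE M00 M10 At large x0 Z10 Zs Zc ZM0 ZM1; set D := enorm _ => ZD ZX.
have Z3 : 3 <= Z by lra.
have C0 := C_gt0 hp; have C1 := tsigma_lt1 hp; have s0 := hsigma_gt0 hp.
have su : 0 < sigma_u p := lt_trans (sigma_l_gt0 hp) (sigma_lu hp).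
have s1 := hsigma_lt1 hp; have L0 := L2_gt0 Pok; have sl0 := sigma_l_gt0 hp.
have l0 : 0 < lambda by rewrite lE divr_gt0.
have D0 : 0 <= D := enorm_ge0 _.
have X0 : 0 <= L2 P * lambda by rewrite mulr_ge0 // ltW.
have den0 := lambda_minus0_den_gt0 p P hp Pok xt M1 lambda t l0 M10 large.
have lm0 := lambda_minus0_gt0 p P hp Pok xt M1 lambda t l0 M10 large.
have denE := lambda_minus0_denE p P hp Pok xt M1 lambda t l0 M10 large.
pose c := (1 - hsigma p) * (2 * sigma_l p).
have c0 : 0 < c by rewrite !mulr_gt0 // subr_gt0.
pose G := L2 P * gamma0 xt M1 lambda; pose S := L2 P * large_step xt lambda t.
have -> : lambda / lambda_minus0 p P xt M1 lambda t
  = c^-1 * (L2 P * lambda_minus0_den p P xt M1 lambda t).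
  have h : lambda = lambda_minus0 p P xt M1 lambda t *
    (c^-1 * (L2 P * lambda_minus0_den p P xt M1 lambda t)).
    have -> : lambda_minus0 p P xt M1 lambda t *
      (c^-1 * (L2 P * lambda_minus0_den p P xt M1 lambda t))
      = c^-1 * L2 P * (lambda_minus0 p P xt M1 lambda t *
         lambda_minus0_den p P xt M1 lambda t) by ring.
    rewrite denE /c /alpha_minus; field.
    by rewrite !gt_eqF // subr_gt0.
  by rewrite {1}h mulrAC divff ?mul1r // gt_eqF.
have -> : L2 P * lambda_minus0_den p P xt M1 lambda t
  = (1 + hsigma p) * (1 + 2 * G) * S + (1 + 2 * C p) * G + G * G.
  by rewrite /lambda_minus0_den /G /S; ring.
have G0 : 0 <= G by rewrite mulr_ge0 ?(ltW L0) // gamma0_ge0.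
have S0 : 0 <= S by rewrite mulr_ge0 ?(ltW L0) // mulr_ge0 ?(ltW l0) // enorm_ge0.
have G6 : G <= Z ^+ 6.
  have -> : G = M1 * (L2 P * lambda) * enorm (xt lambda - xt 0).
    by rewrite /G /gamma0; ring.
  apply: (@le_powM _ _ _ _ 4 2).
  - by rewrite mulr_ge0 // ltW.
  - exact: enorm_ge0.
  - by apply: (@le_powM _ _ _ _ 1 3) => //; exact: ltW.
  apply: le_trans x0 _.
  by apply: (@le_powM _ _ _ _ 1 1) => //; exact: ltW.
have S10 : S <= Z ^+ 10.
  have -> : S = L2 P * lambda * enorm (pt t - xt lambda) by rewrite /S /large_step mulrA.
  apply: (@le_powM _ _ _ _ 3 7) => //; first exact: enorm_ge0.
  have := dist_ANS_le_minimizer p P hp Pok delta lambda _ _ D d0 l0 At erefl.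
  have -> : lambda * delta = C p by rewrite lE divfK // gt_eqF.
  rewrite -ler_pdivlMl ?subr_gt0 // => /le_trans; apply.
  have XD0 : 0 <= L2 P * lambda * D by rewrite mulr_ge0.
  apply: (@le_powM _ _ _ _ 1 6).
  - by rewrite invr_ge0 subr_ge0 ltW.
  - by rewrite mulr_ge0 //; lra.
  - by [].
  apply: (@le_powM _ _ _ _ 1 5) => //; first by lra.
  apply: (le_powD Z3 _ _ 1 4); first by rewrite expr1; lra.
  by apply: (@le_powM _ _ _ _ 3 1).
have t1 : (1 + hsigma p) * (1 + 2 * G) * S <= Z ^+ 19.
  have h2 : 2 * G <= Z ^+ 7.
    by apply: (@le_powM _ _ _ _ 1 6) => //; rewrite expr1; lra.
  apply: (@le_powM _ _ _ _ 9 10) => //; first by rewrite mulr_ge0 //; lra.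
  apply: (@le_powM _ _ _ _ 1 8); [by lra|by lra|by rewrite expr1; lra|].
  by apply: (le_powD Z3 _ _ 1 7) => //; rewrite expr1; lra.
have t2 : (1 + 2 * C p) * G <= Z ^+ 7.
  by apply: (@le_powM _ _ _ _ 1 6) => //; [by lra|by rewrite expr1; lra].
have t3 : G * G <= Z ^+ 12 by apply: (@le_powM _ _ _ _ 6 6).
apply: (@le_powM _ _ _ _ 1 21) => //.
- by rewrite invr_ge0 ltW.
- by do !apply: addr_ge0; do ?[apply: mulr_ge0 => //]; lra.
apply: (le_powD Z3 _ _ 20 12) => //.
exact: (le_powD Z3 _ _ 19 7).
Qed.

End Search.

(** * The number of oracle calls *)

Lemma le_expR_bigmax_ln {R : realType} (s : seq R) r : r \in s ->
  r <= expR (\big[Num.max/1]_(q <- s) ln q).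
Proof.
move=> rs; have [r0|r0] := ltP 0 r; last exact: le_trans r0 (expR_ge0 _).
by rewrite -[X in X <= _]lnK ?posrE // ler_expR; apply: le_bigmax_seq.
Qed.

Theorem theorem4p2 (R : realType) (p : params R) (hp : params_ok p) :
  exists K : R, 0 < K /\
  forall (d : nat) (P : problem R d) (rho eps M0 M1 : R)
    (A : nat -> R) (x y : nat -> 'rV[R]_d)
    (delta : nat -> R) (t : nat -> triple R d) (k : nat)
    (t_minus0 : triple R d) (ts : nat -> triple R d),
  let xt := fun j : nat => curve (A j) (x j) (y j) in
  let delta_k := delta k.+1 in
  let lambda_plus0 := C p / delta_k in
  let lminus0 := lambda_minus0 p P (xt k) M1 lambda_plus0 (t k) in
  let mid := midpoint p P (xt k) M1 lambda_plus0 (t k) ts in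
  let acc := accepted p P (xt k) M1 lambda_plus0 (t k) ts in
  problem_ok P -> 0 < rho -> 0 < eps -> 0 < M0 -> 0 < M1 ->
  (forall j : nat, 0 <= A j) ->
  (* delta j.+1 is the accuracy delta_j at the end of the search of iteration j *)
  delta 0%N = delta_init p ->
  (forall j : nat, (j <= k)%N ->
     delta_search p P rho eps (xt j)
       (Num.min (gamma p * delta j) (delta_max p)) (delta j.+1) (t j)) ->
  (forall s r : R, 0 < r -> r <= s ->
     enorm (xt k s - xt k r)
       <= Num.min (M0 / r * (s - r)) (M1 * enorm (xt k s - xt k 0))) ->
  (* the bisection search is invoked *)
  alpha_plus p P < large_step (xt k) lambda_plus0 (t k) ->
  (* oracle answers: one at lambda_-^0, then one per midpoint until acceptance *)
  computed p P rho eps delta_k lminus0 (xt k lminus0) t_minus0 ->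
  (forall n : nat, (forall i : nat, (i < n)%N -> ~~ acc i) ->
     computed p P rho eps delta_k (mid n) (xt k (mid n)) (ts n)) ->
  exists n : nat,
    [/\ forall i : nat, (i < n)%N -> ~~ acc i,
        0 < mid n,
        ANS p P delta_k (mid n) (xt k (mid n)) (ts n),
        alpha_minus p P <= mid n * enorm (pt (ts n) - xt k (mid n)) <= alpha_plus p P
      & (* n.+2 oracle calls *)
        n.+2%:R <= K * \big[Num.max/1]_(r <- [:: L2 P;
          enorm (xt k lambda_plus0 - xstar P); M1; M0; Lh P; rho^-1; eps^-1]) ln r].
Proof.
pose w := C p / delta_init p + 8 * gamma p.
pose ic := ((1 - hsigma p) * (2 * sigma_l p))^-1.
pose c0 := 10 + w + (1 - hsigma p)^-1 + ic + (gap_const p)^-1.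
have C0 := C_gt0 hp; have i0 := delta_init_gt0 hp; have g1 := gamma_gt1 hp.
have s1 := hsigma_lt1 hp; have sl0 := sigma_l_gt0 hp.
have w0 : 0 < w by rewrite addr_gt0 ?divr_gt0 // mulr_gt0 // (lt_trans ltr01).
have is0 : 0 < (1 - hsigma p)^-1 by rewrite invr_gt0 subr_gt0.
have ic0 : 0 < ic by rewrite invr_gt0 !mulr_gt0 // subr_gt0.
have k0 := gap_const_gt0 p hp.
have ik0 : 0 < (gap_const p)^-1 by rewrite invr_gt0.
have c010 : 10 <= c0 by rewrite /c0; lra.
have lnc0 : 0 <= ln c0 by rewrite ln_ge0 //; lra.
have ln20 : 0 < ln (2 : R) by rewrite ln_gt0 // ltr1n.
(* The bound [2 ^ n <= Z ^ 28] with [Z = c0 * expR M] has the logarithm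
[n * ln 2 <= 28 * (ln c0 + M)], and [M] is at least 1. *)
exists (28 * (ln c0 + 1) / ln 2 + 2); split.
  by rewrite addr_gt0 // divr_gt0 // mulr_gt0 //; lra.
move=> d P rho eps M0 M1 A x y delta t k t_minus0 ts xt delta_k lambda lm mid acc.
move=> Pok rho0 eps0 M00 M10 A0 dE search lip large Am Ats.
set logs := [:: _; _; _; _; _; _; _].
set M := \big[Num.max/1]_(r <- logs) ln r; pose B := expR M.
have leB r : r \in logs -> r <= B by exact: le_expR_bigmax_ln.
have M1le : 1 <= M by exact: bigmax_ge_id.
have B1 : 1 <= B by rewrite -expR0 ler_expR (le_trans ler01).
have LB : L2 P <= B by apply: leB; rewrite !inE eqxx ?orbT.
have DB : enorm (xt k lambda - xstar P) <= B by apply: leB; rewrite !inE eqxx ?orbT.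
have M1B : M1 <= B by apply: leB; rewrite !inE eqxx ?orbT.
have M0B : M0 <= B by apply: leB; rewrite !inE eqxx ?orbT.
have rB : rho^-1 <= B by apply: leB; rewrite !inE eqxx ?orbT.
have eB : eps^-1 <= B by apply: leB; rewrite !inE eqxx ?orbT.
have L0 := L2_gt0 Pok.
have B2 : B <= B ^+ 2 by rewrite expr2 ler_peMl // (le_trans ler01).
have B20 : 0 <= B ^+ 2 by rewrite sqr_ge0.
have [dk0 XW [At _]] : [/\ 0 < delta_k, L2 P * lambda <= w * B ^+ 2
    & computed p P rho eps delta_k lambda (xt k lambda) (t k)].
  apply: (accuracy_lower p P hp Pok rho eps B (w * B ^+ 2) xt delta t k
    rho0 eps0 B1 LB rB eB _ _ dE search k (leqnn k)).
    rewrite /w; have : 0 <= C p / delta_init p * B ^+ 2.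
      by rewrite mulr_ge0 // divr_ge0 // ltW.
    by lra.
  apply: (@le_trans _ _ (B ^+ 2 * (C p / delta_init p))).
    by rewrite ler_wpM2r ?divr_ge0 ?(ltW C0) ?(ltW i0) // (le_trans LB).
  rewrite mulrC ler_wpM2r // /w lerDl; lra.
have l0 : 0 < lambda by rewrite divr_gt0.
(* All constants and all data are below the single number [Z]. *)
pose Z := c0 * B.
have c0Z : c0 <= Z by rewrite ler_peMr //; lra.
have BZ : B <= Z by rewrite ler_peMl ?expR_ge0 //; lra.
have Z3 : 3 <= Z by lra.
have XZ : L2 P * lambda <= Z ^+ 3.
  apply: le_trans XW _; apply: (@le_powM _ _ _ _ 1 2) => //; first exact: ltW.
    by rewrite expr1 (le_trans _ c0Z) // /c0; lra.
  by rewrite lerXn2r // nnegrE ?expR_ge0 //; lra.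
have x0 : enorm (xt k lambda - xt k 0) <= 10 * M0.
  apply: curve_dist0_le => // s r r0 rs.
  by have := lip s r r0 rs; rewrite le_min => /andP[].
have ratio : lambda / lm <= Z ^+ 22.
  apply: (bracket_ratio_le p P hp Pok delta_k M0 M1 Z (xt k) (t k) lambda dk0 erefl
    M00 M10 At large x0).
  - by lra.
  - by rewrite (le_trans _ c0Z) // /c0; lra.
  - by rewrite -/ic (le_trans _ c0Z) // /c0; lra.
  - exact: le_trans BZ.
  - exact: le_trans BZ.
  - exact: le_trans BZ.
  - exact: XZ.
have Ats' n : (forall i, (i < n)%N -> ~~ acc i) ->
  ANS p P delta_k (mid n) (xt k (mid n)) (ts n) by move=> /Ats[].
have lm0 : 0 < lm := lambda_minus0_gt0 p P hp Pok (xt k) M1 lambda (t k) l0 M10 large.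
have Q0 : 0 <= 1 + L2 P * lambda * M0.
  by rewrite addr_ge0 // mulr_ge0 ?(ltW M00) // mulr_ge0 // ltW.
have count n : (forall i, (i < n)%N -> ~~ acc i) ->
    n.+2%:R <= (28 * (ln c0 + 1) / ln 2 + 2) * M.
  move=> nacc.
  have := bisection_count p P hp Pok delta_k M0 M1 (xt k) (t k) t_minus0 ts
    dk0 M00 M10 lip At large (proj1 Am) Ats' n nacc.
  rewrite -ler_pdivlMr // => h.
  have {}h : 2 ^+ n <= Z ^+ 28.
    apply: le_trans h _; apply: (@le_powM _ _ _ _ 27 1).
    - by rewrite mulr_ge0 // divr_ge0 // ltW.
    - exact: ltW.
    - apply: (@le_powM _ _ _ _ 22 5) => //.
      + by rewrite divr_ge0 // ltW.
      apply: (le_powD Z3 _ _ 1 4); first by rewrite expr1; lra.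
      apply: (@le_powM _ _ _ _ 3 1) => //; first by rewrite mulr_ge0 // ltW.
        exact: ltW.
      by rewrite expr1 (le_trans M0B).
    by rewrite expr1 (le_trans _ c0Z) // /c0; lra.
  have Z0 : 0 < Z by lra.
  move: h; rewrite -ler_ln ?posrE ?exprn_gt0 // !lnXn //.
  rewrite /Z lnM ?posrE ?expR_gt0 //; last lra.
  rewrite expRK -[ln 2 *+ n]mulr_natl -[_ *+ 28]mulr_natl => h.
  have h2 : n%:R <= 28 * (ln c0 + 1) / ln 2 * M.
    rewrite mulrAC ler_pdivlMr // (le_trans h) // -mulrA ler_pM2l //.
    rewrite mulrDl mul1r lerD2r ler_peMr //.
  rewrite mulrDl -[n.+2]addn2 natrD lerD // ler_peMr //.
have [n accn] : exists n, acc n.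
  apply: contrapT => nacc.
  have nac i : ~~ acc i by apply/negP => ai; apply: nacc; exists i.
  set KM := (_ * M) in count.
  have := count (Num.bound KM) (fun i _ => nac i).
  have KM0 : 0 <= KM by apply: le_trans (count 0%N (fun i _ => nac i)).
  have := archi_boundP KM0; rewrite -[(Num.bound KM).+2]addn2 natrD; lra.
have [m accm mmin] := ex_minnP (ex_intro _ n accn).
have nacc i : (i < m)%N -> ~~ acc i.
  by move=> im; apply/negP => /mmin; rewrite leqNgt im.
exists m; split => //.
- have [hlo hhi hw _ _] := bracket_invariant p P hp Pok delta_k M0 M1 (xt k) (t k)
    t_minus0 ts dk0 M10 lip At large (proj1 Am) Ats' m nacc.
  have w_gt0 : 0 < lambda - lm.
    by rewrite subr_gt0; exact: lambda_minus0_lt.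
  move: w_gt0; rewrite -/lm in hlo; rewrite -hw pmulr_lgt0 ?exprn_gt0 // => w_gt0.
  rewrite /mid /midpoint; lra.
- exact: Ats'.
- exact: count.
Qed.
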